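(* Let $\mathcal{N}\subset\mathcal{M}$ be a unital, connected inclusion of finite-dimensional C*-algebras, $\mathcal{N}\cong\bigoplus_{j=1}^nM_{k_j}(\mathbb{C})$ and $\mathcal{M}\cong\bigoplus_{i=1}^mM_{h_i}(\mathbb{C})$. Let $\Lambda$ be its Bratteli inclusion matrix, $k=(k_1,\ldots,k_n)^t$, $h=(h_1,\ldots,h_m)^t$ (so $\Lambda k=h$), and $d:=\|\Lambda\|$. Then: (i) the matrix dimension $D$ equals the Jones index matrix $\Lambda^{\mathcal{M}}_{\mathcal{N}}$, and both equal $\Lambda$; (ii) the inclusion is extremal, i.e. the minimal conditional expectation $E^0$ equals the Markov-trace-preserving expectation $E^\tau$; (iii) the inclusion is super-extremal if and only if $\Lambda^th=d^2k$.
   Context: Connected means $\mathcal{Z}(\mathcal{N})\cap\mathcal{Z}(\mathcal{M})=\mathbb{C}\mathbb{1}$. The Bratteli inclusion matrix $\Lambda=(\Lambda_{ij})$ is $m\times n$, where $\Lambda_{ij}$ is the multiplicity with which the $j$-th summand of $\mathcal{N}$ embeds into the $i$-th summand of $\mathcal{M}$. $\|\cdot\|$ is the operator norm for Euclidean norms. Let $p_i$ and $q_j$ be the minimal central projections of $\mathcal{M}$ and $\mathcal{N}$. The matrix dimension $D$ has entries $d_{ij}=[q_j\mathcal{M}p_iq_j:\mathcal{N}p_iq_j]_0^{1/2}$ if $p_iq_j\neq0$ and $0$ otherwise. Here $[\cdot:\cdot]_0=\inf_E\|\mathrm{Ind}(E)\|$ is the minimal index over conditional expectations, with $\mathrm{Ind}$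 the Kosaki index. The Jones index matrix $\Lambda^{\mathcal{M}}_{\mathcal{N}}$ has entries $[q_j\mathcal{M}p_iq_j:\mathcal{N}p_iq_j]^{1/2}$ (square root of the Jones index defined via the trace) if $p_iq_j\neq0$ and $0$ otherwise. $E^0$ is the unique expectation $\mathcal{M}\to\mathcal{N}$ minimizing $\|\mathrm{Ind}(E)\|$. The Markov trace $\tau$ of the inclusion is the unique faithful tracial state on $\mathcal{M}$ whose trace vector $s$ ($s_i$ = value of $\tau$ on a minimal projection of the $i$-th summand) satisfies $\Lambda\Lambda^ts=\|\Lambda\|^2s$. $E^\tau$ is the unique $\tau$-preserving conditional expectation $\mathcal{M}\to\mathcal{N}$. Let $\nu_j$ be the squared entries of the $\ell^2$-normalized positive Perron–Frobenius eigenvector of $D^tD$, and set $\omega_l(q_j)=\nu_j$ (a state on $\mathcal{Z}(\mathcal{N})$). The inclusion is called extremal if $E^0=E^\tau$, and super-extremal if it is extremal and in addition $\omega_l=\tau|_{\mathcal{Z}(\mathcal{N})}$. (This is equivalent to the spherical state $\omega_l\circ E^0$ on $\mathcal{N}'\cap\mathcal{M}$ coinciding with $\tau|_{\mathcal{N}'\cap\mathcal{M}}$.) *)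

(* Defs.v *)
(* Finite-dimensional C*-algebras are modelled concretely as
   block-diagonal (multimatrix) subalgebras of square matrices over an
   arbitrary numClosedFieldType C (the complex numbers being the intended
   instance; algC is an available instance). *)
From HB Require Import structures.
From mathcomp Require Import all_boot all_order all_algebra.
From Stdlib Require Import ClassicalEpsilon.
Set Implicit Arguments.
Unset Strict Implicit.
Unset Printing Implicit Defensive.
Import Order.TTheory GRing.Theory Num.Theory.
Local Open Scope ring_scope.

Section Generic.
Variable C : numClosedFieldType.

Definition is_lubC (S : C -> Prop) (r : C) :=
  (forall x, S x -> x <= r) /\ (forall u, (forall x, S x -> x <= u) -> r <= u).
Definition is_glbC (S : C -> Prop) (r : C) :=
  (forall x, S x -> r <= x) /\ (forall u, (forall x, S x -> u <= x) -> u <= r).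
Definition supC (S : C -> Prop) : C := epsilon (inhabits 0) (is_lubC S).
Definition infC (S : C -> Prop) : C := epsilon (inhabits 0) (is_glbC S).

Definition vnorm p (v : 'cV[C]_p) : C := sqrtC (\sum_i `|v i 0| ^+ 2).
Definition opnorm p q (A : 'M[C]_(p, q)) : C :=
  supC (fun r => exists v : 'cV[C]_q, vnorm v <= 1 /\ r = vnorm (A *m v)).

Definition adj N (A : 'M[C]_N) : 'M[C]_N := (map_mx Num.conj A)^T.
Definition psd N (A : 'M[C]_N) := exists B : 'M[C]_N, A = adj B *m B.

Definition condexp N (B A : 'M[C]_N -> Prop) (E : 'M[C]_N -> 'M[C]_N) :=
  [/\ forall x, B x -> A (E x),
      forall a, A a -> E a = a,
      forall (c : C) x y, B x -> B y -> E (c *: x + y) = c *: E x + E y,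
      forall a1 a2 x, A a1 -> A a2 -> B x -> E (a1 *m x *m a2) = a1 *m E x *m a2 &
      forall x, B x -> psd x -> psd (E x)].

(* X is the (Watatani = Kosaki, in finite dimension) index Ind(E) of E,
   computed from a finite quasi-basis *)
Definition is_index N (B : 'M[C]_N -> Prop) (E : 'M[C]_N -> 'M[C]_N)
    (X : 'M[C]_N) :=
  exists us : seq ('M[C]_N * 'M[C]_N),
    (forall uv, uv \in us -> B uv.1 /\ B uv.2) /\
    (forall x, B x -> x = \sum_(uv <- us) uv.1 *m E (uv.2 *m x)
                    /\ x = \sum_(uv <- us) E (x *m uv.1) *m uv.2) /\
    X = \sum_(uv <- us) uv.1 *m uv.2.

Definition minindex N (B A : 'M[C]_N -> Prop) : C :=
  infC (fun r => exists E X, condexp B A E /\ is_index B E X /\ r = opnorm X).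

(* Jones index of an inclusion of factors A ⊂ B with common unit e, via the
   trace: Ind(E_tr) = [B : A] e, E_tr the trace-preserving expectation *)
Definition jones N (B A : 'M[C]_N -> Prop) (e : 'M[C]_N) : C :=
  epsilon (inhabits 0) (fun c => exists E X, condexp B A E /\
     (forall x, B x -> \tr (E x) = \tr x) /\ is_index B E X /\ X = c *: e).

Definition blockdiag p (s : 'I_p -> nat) (A : 'M[C]_(\sum_i s i)) :=
  A = \mxdiag_i (submxblock A i i).
Definition blockunit p (s : 'I_p -> nat) (i : 'I_p) : 'M[C]_(\sum_i s i) :=
  \mxdiag_(i' < p) (if i' == i then 1%:M else 0).
Definition minproj p (s : 'I_p -> nat) (i : 'I_p) : 'M[C]_(\sum_i s i) :=
  \mxdiag_(i' < p) (if i' == i then pid_mx 1 else 0).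

Definition center N (S : 'M[C]_N -> Prop) (z : 'M[C]_N) :=
  S z /\ forall y, S y -> z *m y = y *m z.

End Generic.
Arguments blockdiag {C p} s A.

Section Inclusion.
Variables (C : numClosedFieldType) (m n : nat) (h : 'I_m -> nat) (k : 'I_n -> nat).
Variable phi : 'M[C]_(\sum_j k j) -> 'M[C]_(\sum_i h i).

Definition is_inclusion :=
  [/\ forall x, blockdiag k x -> blockdiag h (phi x),
      forall (c : C) x y, blockdiag k x -> blockdiag k y ->
        phi (c *: x + y) = c *: phi x + phi y,
      forall x y, blockdiag k x -> blockdiag k y -> phi (x *m y) = phi x *m phi y,
      forall x, blockdiag k x -> phi (adj x) = adj (phi x) &
      phi 1%:M = 1%:M] /\
  (forall x y, blockdiag k x -> blockdiag k y -> phi x = phi y -> x = y).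

Definition Mset (x : 'M[C]_(\sum_i h i)) := blockdiag h x.
Definition Nset (y : 'M[C]_(\sum_i h i)) := exists x, blockdiag k x /\ y = phi x.

Definition connected := forall z, center Nset z -> center Mset z -> exists c : C, z = c%:M.

Definition pM (i : 'I_m) : 'M[C]_(\sum_i h i) := blockunit C h i.
Definition qN (j : 'I_n) : 'M[C]_(\sum_i h i) := phi (blockunit C k j).

(* Bratteli inclusion matrix: multiplicity of the j-th summand of N in the
   i-th summand of M = rank of the image in p_i of a minimal projection *)
Definition bratteli : 'M[C]_(m, n) :=
  \matrix_(i, j) (\rank (pM i *m phi (minproj C k j)))%:R.

Definition hvec : 'cV[C]_m := \col_i (h i)%:R.
Definition kvec : 'cV[C]_n := \col_j (k j)%:R.

Definition redM i j (z : 'M[C]_(\sum_i h i)) :=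
  exists x, Mset x /\ z = qN j *m x *m pM i *m qN j.
Definition redN i j (z : 'M[C]_(\sum_i h i)) :=
  exists y, Nset y /\ z = y *m pM i *m qN j.

Definition matdim : 'M[C]_(m, n) :=
  \matrix_(i, j) (if pM i *m qN j != 0 then sqrtC (minindex (redM i j) (redN i j)) else 0).
Definition jonesmat : 'M[C]_(m, n) :=
  \matrix_(i, j) (if pM i *m qN j != 0
                  then sqrtC (jones (redM i j) (redN i j) (pM i *m qN j)) else 0).

Definition is_minexp (E0 : 'M[C]_(\sum_i h i) -> 'M[C]_(\sum_i h i)) :=
  condexp Mset Nset E0 /\ exists X0, is_index Mset E0 X0 /\
    forall E X, condexp Mset Nset E -> is_index Mset E X -> opnorm X0 <= opnorm X.

Definition trstate (s : 'cV[C]_m) (x : 'M[C]_(\sum_i h i)) : C :=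
  \sum_i s i 0 * \tr (submxblock x i i).
Definition markov_vec (s : 'cV[C]_m) :=
  [/\ forall i, 0 < s i 0, \sum_i (h i)%:R * s i 0 = 1 &
      bratteli *m bratteli^T *m s = (opnorm bratteli) ^+ 2 *: s].
Definition preserves (s : 'cV[C]_m) (E : 'M[C]_(\sum_i h i) -> 'M[C]_(\sum_i h i)) :=
  condexp Mset Nset E /\ forall x, Mset x -> trstate s (E x) = trstate s x.

Definition extremal :=
  forall E0 s Et, is_minexp E0 -> markov_vec s -> preserves s Et ->
    forall x, Mset x -> E0 x = Et x.

Definition pf_vec (w : 'cV[C]_n) :=
  [/\ forall j, 0 < w j 0, \sum_j w j 0 ^+ 2 = 1 &
      matdim^T *m matdim *m w = (opnorm matdim) ^+ 2 *: w].

(* omega_l = tau on Z(N) = span{q_j} *)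
Definition superextremal :=
  extremal /\ forall s w, markov_vec s -> pf_vec w ->
    forall j, trstate s (qN j) = w j 0 ^+ 2.

End Inclusion.

(* Main.v *)
(* Nothing about the structure of the inclusion is used beyond the images
   [F r c] of the matrix units of N.  Fix a faithful trace tau on M with trace
   vector s.  An expectation E : M -> N has a density h commuting with N,
   tau (E x) = tau (h x); a quasi-basis of E makes h invertible, and the index
   of E is sum_i s_i^-1 tr (p_i T h^-1) p_i, where
   T = sum_j (tau (f_j) / k_j) q_j for f_j a minimal projection of the j-th
   summand.  Since
     tau (T h^-1) - tau T = tau (T (h - 1) h^-1 (h - 1)) >= 0,
   the s_i^2-weighted sum of the entries of the index is least exactly when
   h = 1, that is, when E is the tau-preserving expectation, whose index is
   sum_i s_i^-1 tr (p_i T) p_i.  For the Markov vector s this is d^2, which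
   gives extremality; for the factor inclusion q_j N p_i q_j in q_j M p_i q_j
   with its trace it is Lambda_ij^2, which gives both entries in (i).  Part (iii)
   is Perron-Frobenius theory: under Lambda^t h = d^2 k the vectors Lambda^t s,
   k and w are all Perron-Frobenius eigenvectors of Lambda^t Lambda, and
   conversely super-extremality forces k to be proportional to w. *)
Require Import Defs.
From HB Require Import structures.
From mathcomp Require Import all_boot all_order all_algebra.
From Stdlib Require Import ClassicalEpsilon.
From mathcomp Require Import ring.
Import Order.TTheory GRing.Theory Num.Theory.
Set Implicit Arguments.
Unset Strict Implicit.
Unset Printing Implicit Defensive.
Local Open Scope ring_scope.

(** * Adjoints of square matrices and the Hilbert-Schmidt form *)

Section Adjoint.
Variables (C : numClosedFieldType) (N : nat).
Implicit Types x y : 'M[C]_N.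

Lemma adj_add x y : adj (x + y) = adj x + adj y.
Proof. by rewrite /adj map_mxD linearD. Qed.
Lemma adj_scale (c : C) x : adj (c *: x) = c^* *: adj x.
Proof. by rewrite /adj map_mxZ linearZ. Qed.
Lemma adj_zero : adj (0 : 'M[C]_N) = 0.
Proof. by rewrite /adj map_mx0 trmx0. Qed.
Lemma adj_opp x : adj (- x) = - adj x.
Proof. by rewrite /adj map_mxN linearN. Qed.
Lemma adj_sum (J : finType) (F : J -> 'M[C]_N) :
  adj (\sum_j F j) = \sum_j adj (F j).
Proof. by apply: (big_morph (@adj C N)); [exact: adj_add | exact: adj_zero]. Qed.
Lemma adj_mul x y : adj (x *m y) = adj y *m adj x.
Proof. by rewrite /adj map_mxM trmx_mul. Qed.
Lemma adjCK x : adj (adj x) = x.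
Proof. by apply/matrixP => i j; rewrite !mxE conjCK. Qed.
Lemma tr_adj x : \tr (adj x) = (\tr x)^*.
Proof.
rewrite /adj mxtrace_tr /mxtrace rmorph_sum.
by apply: eq_bigr => i _; rewrite mxE.
Qed.

Lemma tr_mul_adjE x : \tr (x *m adj x) = \sum_i \sum_j `|x i j| ^+ 2.
Proof.
apply: eq_bigr => i _; rewrite mxE; apply: eq_bigr => j _.
by rewrite !mxE normCK.
Qed.

Lemma tr_mul_adj_ge0 x : 0 <= \tr (x *m adj x).
Proof.
by rewrite tr_mul_adjE; do 2!apply: sumr_ge0 => ? _; rewrite exprn_ge0.
Qed.

Lemma tr_mul_adj_eq0 x : \tr (x *m adj x) = 0 -> x = 0.
Proof.
rewrite tr_mul_adjE => H; apply/matrixP => i j; rewrite mxE.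
have /psumr_eq0P H1 : forall i, true -> 0 <= \sum_j `|x i j| ^+ 2.
  by move=> i' _; apply: sumr_ge0 => ? _; rewrite exprn_ge0.
have /psumr_eq0P H2 : forall j, true -> 0 <= `|x i j| ^+ 2.
  by move=> ? _; rewrite exprn_ge0.
have /eqP := H2 (H1 H i isT) j isT.
by rewrite expf_eq0 /= normr_eq0 => /eqP.
Qed.

End Adjoint.

(* Positivity of a sesquilinear form along [x + a y], when the form vanishes
   at [x], kills the cross term. *)
Lemma cross_term_eq0 (C : numClosedFieldType) (z r : C) :
  0 <= r -> (forall a : C, 0 <= a^* * z + a * z^* + `|a| ^+ 2 * r) -> z = 0.
Proof.
move=> r0 H; apply/eqP/negP => /negP z0.
have r1 : 0 < r + 1 by rewrite ltr_wpDl.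
(* The test value is [a = - u z]; dividing by [r + 1] instead of [r] allows [r = 0], and the form
   becomes [- u |z|^2 (1 + u) < 0]. *)
pose u := (r + 1)^-1; have u0 : 0 < u by rewrite invr_gt0.
have ur : u * r = 1 - u.
  by apply/eqP; rewrite -subr_eq0 opprB addrA -[X in _ + X - 1](mulr1 u) -mulrDr
     mulVf ?subrr // gt_eqF.
have w0 : 0 < z * z^* by rewrite -normCK exprn_gt0 // normr_gt0.
have := H (- (u * z)).
rewrite normrN normrM exprMn (ger0_norm (ltW u0)) [`|z| ^+ 2]normCK.
rewrite rmorphN rmorphM /= (geC0_conj (ltW u0)).
have -> : - (u * z^*) * z + - (u * z) * z^* + u ^+ 2 * (z * z^*) * r =
          - (u * (z * z^*) * (1 + u)).
  have -> : u ^+ 2 * (z * z^*) * r = u * (z * z^*) * (u * r) by ring.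
  by rewrite ur; ring.
have uw : 0 < u * (z * z^*) * (1 + u).
  by apply: mulr_gt0; [exact: mulr_gt0 | rewrite addr_gt0].
by rewrite oppr_ge0 lt_geF.
Qed.

(** * Spectral theory and the operator norm *)

(** [supC] is a choice made by [epsilon]: exhibiting one least upper bound activates its
    specification, and antisymmetry of the order then identifies the chosen value. *)
Lemma supC_lub (C : numClosedFieldType) (S : C -> Prop) r : is_lubC S r -> supC S = r.
Proof.
move=> hr; have : is_lubC S (supC S) by apply: epsilon_spec; exists r.
by case: hr => u1 l1 [u2 l2]; apply/le_anti; rewrite l1 // l2.
Qed.

Lemma infC_glb (C : numClosedFieldType) (S : C -> Prop) r : is_glbC S r -> infC S = r.
Proof.
move=> hr; have : is_glbC S (infC S) by apply: epsilon_spec; exists r.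
by case: hr => u1 l1 [u2 l2]; apply/le_anti; rewrite l1 // l2.
Qed.

(** The order on [C] is partial, so a finite family has a maximum only once its values are
    comparable, which reality provides. The index [j0] excludes the empty family. *)
Lemma exists_max (C : numClosedFieldType) (J : finType) (f : J -> C) (j0 : J) :
  (forall j, f j \is Num.real) -> exists j, forall i, f i <= f j.
Proof.
move=> fr; suff [j H] : exists j, forall i, i \in enum J -> f i <= f j.
  by exists j => i; apply: H; rewrite mem_enum.
elim: (enum J) => [|i s [j H]]; first by exists j0.
have [le_ij|/ltW le_ji] := real_leP (fr i) (fr j).
  by exists j => k; rewrite inE => /predU1P[->|/H].
by exists i => k; rewrite inE => /predU1P[->|/H /le_trans]; [exact: lexx | apply].
Qed.

Section Spectral.
Variable C : numClosedFieldType.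

(** The rectangular form of [adj], convertible to it on square matrices. *)
Definition ctr p q (A : 'M[C]_(p, q)) : 'M[C]_(q, p) := (map_mx Num.conj A)^T.
Definition vsq p (v : 'cV[C]_p) : C := \sum_i `|v i 0| ^+ 2.

Lemma ctr_mul p q r (A : 'M[C]_(p, q)) (B : 'M[C]_(q, r)) :
  ctr (A *m B) = ctr B *m ctr A.
Proof. by rewrite /ctr map_mxM trmx_mul. Qed.

Lemma ctr_delta p q (i : 'I_p) (j : 'I_q) : ctr (delta_mx i j) = delta_mx j i.
Proof. by rewrite /ctr map_delta_mx trmx_delta. Qed.

Lemma ctrK p q (A : 'M[C]_(p, q)) : ctr (ctr A) = A.
Proof. by apply/matrixP => i j; rewrite !mxE conjCK. Qed.

Lemma vsqE p (v : 'cV[C]_p) : vsq v = (ctr v *m v) 0 0.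
Proof. by rewrite mxE; apply: eq_bigr => i _; rewrite !mxE normCK mulrC. Qed.

Lemma vsq_ge0 p (v : 'cV[C]_p) : 0 <= vsq v.
Proof. by apply: sumr_ge0 => i _; rewrite exprn_ge0. Qed.

Lemma vnorm_ge0 p (v : 'cV[C]_p) : 0 <= vnorm v.
Proof. by rewrite sqrtC_ge0 vsq_ge0. Qed.

Lemma vnorm_sq p (v : 'cV[C]_p) : vnorm v ^+ 2 = vsq v.
Proof. exact: sqrtCK. Qed.

Lemma vsqZ p (c : C) (v : 'cV[C]_p) : vsq (c *: v) = `|c| ^+ 2 * vsq v.
Proof. by rewrite mulr_sumr; apply: eq_bigr => i _; rewrite mxE normrM exprMn. Qed.

Lemma vsq_eq0 p (v : 'cV[C]_p) : vsq v = 0 -> v = 0.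
Proof.
move=> v0; apply/matrixP => i j; rewrite ord1 mxE.
have /psumr_eq0P /(_ v0) /(_ i isT) /eqP : forall i, true -> 0 <= `|v i 0| ^+ 2.
  by move=> ? _; rewrite exprn_ge0.
by rewrite expf_eq0 /= normr_eq0 => /eqP.
Qed.

Lemma hermitian_spectral q (H : 'M[C]_q) : ctr H = H ->
  exists (U : 'M[C]_q) (d : 'rV[C]_q),
    [/\ U *m ctr U = 1%:M, ctr U *m U = 1%:M & H = ctr U *m diag_mx d *m U].
Proof.
move=> hH; have nH : H \is normalmx.
  by apply/normalmxP; rewrite -map_trmx -/(ctr H) hH.
have /orthomx_spectralP eH := nH.
exists (spectralmx H), (spectral_diag H).
have uU := spectral_unitarymx H.
have UU : spectralmx H *m ctr (spectralmx H) = 1%:M.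
  by have /unitarymxP := uU; rewrite -map_trmx.
split=> //; first exact: mulmx1C.
by rewrite {1}eH (invmx_unitary uU) -map_trmx.
Qed.

(** Testing the form on eigenvectors shows that the eigenvalues are nonnegative, so the diagonal
    part has a square root, which supplies the factor required by [psd]. *)
Lemma psd_form q (H : 'M[C]_q) : adj H = H ->
  (forall w : 'cV[C]_q, 0 <= (ctr w *m H *m w) 0 0) -> psd H.
Proof.
move=> /hermitian_spectral [U [d [UU' U'U eH]]] pos.
have d_ge0 i : 0 <= d 0 i.
  have := pos (ctr U *m delta_mx i 0); rewrite eH ctr_mul ctrK.
  have -> : ctr (delta_mx i 0 : 'cV[C]_q) *m U *m (ctr U *m diag_mx d *m U) *m
     (ctr U *m (delta_mx i 0 : 'cV[C]_q)) = delta_mx 0 i *m (U *m ctr U) *m diag_mx d *m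
     (U *m ctr U) *m (delta_mx i 0 : 'cV[C]_q).
    by rewrite ctr_delta !mulmxA.
  by rewrite UU' !mulmx1 -rowE -colE !mxE eqxx mulr1n.
exists (diag_mx (\row_i sqrtC (d 0 i)) *m U).
have -> : adj (diag_mx (\row_i sqrtC (d 0 i)) *m U) = ctr U *m diag_mx (\row_i sqrtC (d 0 i)).
  rewrite /adj map_mxM trmx_mul; congr (_ *m _).
  apply/matrixP => i j; rewrite !mxE eq_sym rmorphMn /=; case: eqP => [->|] //.
  by rewrite !mulr1n geC0_conj ?sqrtC_ge0.
rewrite eH !mulmxA -(mulmxA _ (diag_mx _) (diag_mx _)) mulmx_diag; congr (_ *m diag_mx _ *m _).
by apply/matrixP => i j; rewrite !mxE ord1 -expr2 sqrtCK.
Qed.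

(** A factorisation [adj b *m b] is not visibly additive; the quadratic form is, hence the detour
    through [psd_form]. *)
Lemma psd_sum q (J : finType) (F : J -> 'M[C]_q) :
  (forall j, psd (F j)) -> psd (\sum_j F j).
Proof.
move=> pF; apply: psd_form => [|w].
  rewrite adj_sum; apply: eq_bigr => j _; have [b ->] := pF j.
  by rewrite adj_mul adjCK.
rewrite mulmx_sumr mulmx_suml summxE; apply: sumr_ge0 => j _.
have [b ->] := pF j.
have -> : ctr w *m (adj b *m b) *m w = ctr (b *m w) *m (b *m w).
  by rewrite ctr_mul !mulmxA.
by rewrite -vsqE vsq_ge0.
Qed.

Lemma gram_spectral p q (A : 'M[C]_(p, q)) : exists (U : 'M[C]_q) (d : 'rV[C]_q),
  [/\ U *m ctr U = 1%:M, ctr U *m U = 1%:M,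
      forall i, 0 <= d 0 i, ctr A *m A = ctr U *m diag_mx d *m U &
      forall v, vsq (A *m v) = \sum_i d 0 i * `|(U *m v) i 0| ^+ 2].
Proof.
have [|U [d [UU' U'U eH]]] := @hermitian_spectral q (ctr A *m A).
  by rewrite ctr_mul ctrK.
have eA v : vsq (A *m v) = \sum_i d 0 i * `|(U *m v) i 0| ^+ 2.
  rewrite vsqE ctr_mul mulmxA -(mulmxA (ctr v)) eH.
  have -> : ctr v *m (ctr U *m diag_mx d *m U) *m v = ctr (U *m v) *m (diag_mx d *m (U *m v)).
    by rewrite ctr_mul !mulmxA.
  rewrite mxE; apply: eq_bigr => i _; rewrite mul_diag_mx !mxE normCK; ring.
exists U, d; split=> // i.
have := vsq_ge0 (A *m (ctr U *m delta_mx i 0)).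
rewrite eA mulmxA UU' mul1mx (bigD1 i) //= big1 ?addr0 => [|j /negPf ne].
  by rewrite mxE !eqxx normr1 expr1n mulr1.
by rewrite mxE ne normr0 expr0n mulr0.
Qed.

Lemma vsq_isometry q (U : 'M[C]_q) v : ctr U *m U = 1%:M -> vsq (U *m v) = vsq v.
Proof. by move=> UU; rewrite !vsqE ctr_mul mulmxA -(mulmxA (ctr v)) UU mulmx1. Qed.

Lemma ler_sqC (x y : C) : 0 <= x -> 0 <= y -> (x ^+ 2 <= y ^+ 2) = (x <= y).
Proof. by move=> x0 y0; rewrite ler_pXn2r. Qed.

(** Diagonalising [ctr A *m A] gives [opnorm A ^+ 2] as its largest eigenvalue, attained at a unit
    eigenvector. The last clause is the equality case, from which Perron-Frobenius eigenvectors are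
    obtained. *)
Lemma opnorm_spec p q (A : 'M[C]_(p, q)) :
  [/\ 0 <= opnorm A,
      forall v, vsq (A *m v) <= opnorm A ^+ 2 * vsq v,
      (0 < q)%N -> exists v, vsq v = 1 /\ vsq (A *m v) = opnorm A ^+ 2 &
      forall v, vsq (A *m v) = opnorm A ^+ 2 * vsq v ->
        ctr A *m A *m v = opnorm A ^+ 2 *: v].
Proof.
have [U [d [UU' U'U d_ge0 eH eA]]] := gram_spectral A.
have vsq1 r (v : 'cV[C]_r) : (vnorm v <= 1) = (vsq v <= 1).
  by rewrite -vnorm_sq -[X in _ = (_ <= X)](expr1n _ 2) ler_sqC ?vnorm_ge0.
(* Without columns the only vector is 0 and the supremum is 0. *)
case: (posnP q) => [q0|q_gt0].
  have z (v : 'cV[C]_q) : v = 0.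
    by apply/matrixP => i; have := ltn_ord i; rewrite {2}q0.
  have -> : opnorm A = 0.
    apply: supC_lub; split=> [x [v [_ ->]]|u H].
      by rewrite (z v) mulmx0 /vnorm big1 ?sqrtC0 // => i _; rewrite mxE normr0 expr0n.
    apply: H; exists 0; split; rewrite ?mulmx0 /vnorm big1 ?sqrtC0 // => i _;
      by rewrite mxE normr0 expr0n.
  split=> // v; rewrite ?(z v) ?mulmx0 ?scaler0 //.
  by rewrite /vsq !big1 ?mulr0 // => i _; rewrite mxE normr0 expr0n.
have [i0 d_max] : exists j, forall i, d 0 i <= d 0 j.
  by apply: exists_max => [|j]; [exact: Ordinal q_gt0 | apply: ger0_real].
have le_d v : vsq (A *m v) <= d 0 i0 * vsq v.
  rewrite eA -(vsq_isometry v U'U) mulr_sumr; apply: ler_sum => i _.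
  by rewrite ler_wpM2r ?exprn_ge0.
pose v0 := ctr U *m delta_mx i0 0 : 'cV[C]_q.
have n0 : vsq (delta_mx i0 0 : 'cV[C]_q) = 1.
  rewrite /vsq (bigD1 i0) //= big1 ?addr0 => [|j /negPf ne].
    by rewrite mxE !eqxx normr1 expr1n.
  by rewrite mxE ne normr0 expr0n.
have n1 : vsq v0 = 1 by rewrite vsq_isometry ?ctrK.
have Av0 : vsq (A *m v0) = d 0 i0.
  rewrite eA mulmxA UU' mul1mx (bigD1 i0) //= big1 ?addr0 => [|j /negPf ne].
    by rewrite mxE !eqxx normr1 expr1n mulr1.
  by rewrite mxE ne normr0 expr0n mulr0.
have eop : opnorm A = sqrtC (d 0 i0).
  apply: supC_lub; split=> [x [v [nv ->]]|u H].
    rewrite -ler_sqC ?vnorm_ge0 ?sqrtC_ge0 // vnorm_sq sqrtCK.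
    by rewrite (le_trans (le_d v)) // ler_piMr -?vsq1.
  by apply: H; exists v0; rewrite vsq1 n1 /vnorm -/(vsq _) Av0.
rewrite eop sqrtCK sqrtC_ge0; split=> // [_|v eq_v]; first by exists v0.
(* Equality makes a sum of nonnegative terms vanish, so each coordinate of [U *m v] is zero or
   belongs to the top eigenvalue. *)
have {}eq_v : \sum_i (d 0 i0 - d 0 i) * `|(U *m v) i 0| ^+ 2 = 0.
  apply/eqP; under eq_bigr do rewrite mulrBl.
  by rewrite sumrB -mulr_sumr -/(vsq _) vsq_isometry // -eA eq_v subrr.
have eq_i i : d 0 i * (U *m v) i 0 = d 0 i0 * (U *m v) i 0.
  have /psumr_eq0P /(_ eq_v) /(_ i isT) /eqP : forall i, true ->
      0 <= (d 0 i0 - d 0 i) * `|(U *m v) i 0| ^+ 2.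
    by move=> j _; rewrite mulr_ge0 ?exprn_ge0 ?subr_ge0.
  rewrite mulf_eq0 expf_eq0 /= normr_eq0 subr_eq0 => /orP[/eqP -> //|/eqP ->].
  by rewrite !mulr0.
rewrite eH -mulmxA -mulmxA mul_diag_mx.
have -> : \matrix_(i, j) (d 0 i * (U *m v) i j) = d 0 i0 *: (U *m v).
  by apply/matrixP => i j; rewrite mxE [RHS]mxE ord1 eq_i.
by rewrite -scalemxAr mulmxA U'U mul1mx.
Qed.

End Spectral.

(** * Index of conditional expectations on multimatrix algebras *)

Section Multimatrix.
Variables (C : numClosedFieldType) (N : nat) (I : finType).
Variables (P : I -> 'M[C]_N) (s : I -> C) (B : 'M[C]_N -> Prop).
Hypothesis P_adj : forall i, adj (P i) = P i.
Hypothesis P_mul : forall i i', P i *m P i' = if i == i' then P i else 0.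
Hypothesis s_gt0 : forall i, 0 < s i.
Hypothesis B_def : forall x, B x <-> x = \sum_i P i *m x *m P i.

(** The unit of [B] is kept apart from [1%:M], so that the same setting covers both a full
    multimatrix algebra and its corners, whose unit may be a proper projection. *)
Definition wunit : 'M[C]_N := \sum_i P i.
Definition wtr (x : 'M[C]_N) : C := \sum_i s i * \tr (P i *m x).
Local Notation e := wunit.
Local Notation tau := wtr.

Lemma P_idem i : P i *m P i = P i. Proof. by rewrite P_mul eqxx. Qed.

Lemma corner_mem x : (forall i, P i *m x = x *m P i) -> e *m x = x -> B x.
Proof.
move=> cx ex; apply/B_def; rewrite -[LHS]ex /wunit mulmx_suml.
by apply: eq_bigr => i _; rewrite -mulmxA -cx mulmxA P_idem.
Qed.

Lemma memB_comm x i : B x -> P i *m x = x *m P i.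
Proof.
move/B_def=> ->; rewrite mulmx_sumr mulmx_suml; apply: eq_bigr => i' _.
rewrite !mulmxA P_mul -!(mulmxA _ (P i') (P i)) P_mul eq_sym.
by case: eqVneq => [->|_]; rewrite ?mul0mx ?mulmx0 // !mulmxA.
Qed.

Lemma memB_mul1l x : B x -> e *m x = x.
Proof.
move=> Bx; rewrite {2}((B_def x).1 Bx) /wunit mulmx_suml.
by apply: eq_bigr => i _; rewrite -mulmxA -(memB_comm i Bx) mulmxA P_idem.
Qed.

Lemma memB_mul1r x : B x -> x *m e = x.
Proof.
move=> Bx; rewrite -{2}(memB_mul1l Bx) /wunit mulmx_suml mulmx_sumr.
by apply: eq_bigr => i _; rewrite (memB_comm i Bx).
Qed.

Lemma memB_wunit : B e.
Proof.
apply: corner_mem => [i|]; rewrite /wunit.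
  rewrite mulmx_sumr mulmx_suml; apply: eq_bigr => i' _.
  by rewrite !P_mul eq_sym; case: eqP => // ->.
rewrite mulmx_suml; apply: eq_bigr => i _; rewrite mulmx_sumr (bigD1 i) //=.
by rewrite P_idem big1 ?addr0 // => i' /negPf ne; rewrite P_mul eq_sym ne.
Qed.

Lemma memB_lin (c : C) x y : B x -> B y -> B (c *: x + y).
Proof.
move=> Bx By; apply: corner_mem => [i|].
  by rewrite mulmxDr mulmxDl -scalemxAr -scalemxAl !(memB_comm i).
by rewrite mulmxDr -scalemxAr !memB_mul1l.
Qed.

Lemma memB0 : B 0.
Proof. by apply: corner_mem => [i|]; rewrite !(mul0mx, mulmx0). Qed.

Lemma memBD x y : B x -> B y -> B (x + y).
Proof. by move=> Bx By; rewrite -[x]scale1r; apply: memB_lin. Qed.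

Lemma memBZ c x : B x -> B (c *: x).
Proof. by move=> Bx; rewrite -[_ *: _]addr0; apply: memB_lin => //; apply: memB0. Qed.

Lemma memBB x y : B x -> B y -> B (x - y).
Proof. by move=> Bx By; rewrite addrC -scaleN1r; apply: memB_lin. Qed.

Lemma memB_sum (J : finType) (F : J -> 'M[C]_N) :
  (forall j, B (F j)) -> B (\sum_j F j).
Proof. by move=> BF; apply: (big_ind B) => //; [exact: memB0 | exact: memBD]. Qed.

Lemma memBM x y : B x -> B y -> B (x *m y).
Proof.
move=> Bx By; apply: corner_mem => [i|]; last by rewrite mulmxA memB_mul1l.
by rewrite mulmxA memB_comm // -!mulmxA memB_comm.
Qed.

Lemma adj_wunit : adj e = e.
Proof. by rewrite /wunit adj_sum; apply: eq_bigr. Qed.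

Lemma memB_adj x : B x -> B (adj x).
Proof.
move=> Bx; apply: corner_mem => [i|].
  by rewrite -(P_adj i) -!adj_mul memB_comm.
by rewrite -{1}adj_wunit -adj_mul memB_mul1r.
Qed.

Lemma memB_corner i x : B (P i *m x *m P i).
Proof.
apply: corner_mem => [i'|].
  rewrite !mulmxA P_mul -!(mulmxA _ (P i) (P i')) P_mul eq_sym.
  by case: eqP => [->|_]; rewrite ?mul0mx ?mulmx0 // !mulmxA.
rewrite /wunit mulmx_suml (bigD1 i) //= !mulmxA P_idem big1 ?addr0 // => i' /negPf ne.
by rewrite !mulmxA P_mul ne !mul0mx.
Qed.

Lemma wtr_lin (c : C) x y : tau (c *: x + y) = c * tau x + tau y.
Proof.
rewrite /wtr mulr_sumr -big_split; apply: eq_bigr => i _ /=.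
by rewrite mulmxDr -scalemxAr mxtraceD mxtraceZ mulrDr mulrCA.
Qed.

Lemma wtr0 : tau 0 = 0.
Proof. by rewrite /wtr big1 // => i _; rewrite mulmx0 mxtrace0 mulr0. Qed.
Lemma wtrD x y : tau (x + y) = tau x + tau y.
Proof. by have := wtr_lin 1 x y; rewrite scale1r mul1r. Qed.
Lemma wtrZ c x : tau (c *: x) = c * tau x.
Proof. by have := wtr_lin c x 0; rewrite !addr0 wtr0 addr0. Qed.
Lemma wtrB x y : tau (x - y) = tau x - tau y.
Proof. by rewrite -scaleN1r wtrD wtrZ mulN1r. Qed.
Lemma wtr_sum (J : finType) (F : J -> 'M[C]_N) :
  tau (\sum_j F j) = \sum_j tau (F j).
Proof. exact: (big_morph tau wtrD wtr0). Qed.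

Lemma wtrC x y : B x -> tau (x *m y) = tau (y *m x).
Proof.
move=> Bx; apply: eq_bigr => i _; congr (_ * _).
by rewrite mulmxA memB_comm // -mulmxA mxtrace_mulC mulmxA.
Qed.

Lemma wtr_adj x : tau (adj x) = (tau x)^*.
Proof.
rewrite /wtr rmorph_sum; apply: eq_bigr => i _ /=.
rewrite rmorphM /= geC0_conj ?(ltW (s_gt0 i)) // -tr_adj adj_mul P_adj.
by rewrite mxtrace_mulC.
Qed.

Lemma wtr_mul_adjE x : tau (x *m adj x) = \sum_i s i * \tr (P i *m x *m adj (P i *m x)).
Proof.
apply: eq_bigr => i _; congr (_ * _).
by rewrite adj_mul P_adj !mulmxA [RHS]mxtrace_mulC !mulmxA P_idem.
Qed.

Lemma wtr_mul_adj_ge0 x : 0 <= tau (x *m adj x).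
Proof.
rewrite wtr_mul_adjE; apply: sumr_ge0 => i _.
by rewrite mulr_ge0 ?(ltW (s_gt0 i)) ?tr_mul_adj_ge0.
Qed.

Lemma wtr_mul_adj_eq0 x : B x -> tau (x *m adj x) = 0 -> x = 0.
Proof.
move=> Bx; rewrite wtr_mul_adjE => H.
have /psumr_eq0P /(_ H) {}H : forall i, true ->
    0 <= s i * \tr (P i *m x *m adj (P i *m x)).
  by move=> i _; rewrite mulr_ge0 ?(ltW (s_gt0 i)) ?tr_mul_adj_ge0.
rewrite -(memB_mul1l Bx) /wunit mulmx_suml big1 // => i _.
apply: tr_mul_adj_eq0; have /eqP := H i isT.
by rewrite mulf_eq0 gt_eqF //= => /eqP.
Qed.

Lemma wtr_nondeg z : B z -> (forall x, B x -> tau (z *m x) = 0) -> z = 0.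
Proof. by move=> Bz H; apply: wtr_mul_adj_eq0 => //; apply/H/memB_adj. Qed.

(** Compressed matrix units span [B] but may be linearly dependent, as [P i] need not be diagonal.
    Together with [ybasis] they form a pair of dual frames for tau, which is all that the expansions
    below use. *)
Definition xbasis (l : I * ('I_N * 'I_N)) := P l.1 *m delta_mx l.2.1 l.2.2 *m P l.1.
Definition ybasis (l : I * ('I_N * 'I_N)) :=
  (s l.1)^-1 *: (P l.1 *m delta_mx l.2.2 l.2.1 *m P l.1).

Lemma memB_xbasis l : B (xbasis l). Proof. exact: memB_corner. Qed.
Lemma memB_ybasis l : B (ybasis l). Proof. exact/memBZ/memB_corner. Qed.

Lemma wtr_corner i z : tau (P i *m z *m P i) = s i * \tr (P i *m z).
Proof.
rewrite /wtr (bigD1 i) //= !mulmxA P_idem big1 ?addr0 => [|i' /negPf ne].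
  by rewrite mxtrace_mulC !mulmxA P_idem.
by rewrite !mulmxA P_mul ne !mul0mx mxtrace0 mulr0.
Qed.

Lemma tr_delta_mul x y (z : 'M[C]_N) : \tr (z *m delta_mx x y) = z y x.
Proof.
rewrite /mxtrace (bigD1 y) //= mxE (bigD1 x) //= mxE !eqxx mulr1.
rewrite big1 ?addr0 => [|i /negPf ne]; last by rewrite mxE ne mulr0.
rewrite big1 ?addr0 // => i /negPf ne; rewrite mxE big1 // => j _.
by rewrite mxE ne andbF mulr0.
Qed.

Lemma delta_sandwich (x y : 'I_N) (z : 'M[C]_N) :
  delta_mx x y *m z *m delta_mx y x = z y y *: delta_mx x x :> 'M[C]_N.
Proof.
apply/matrixP => a b; rewrite mxE (bigD1 y) //= [X in _ * X]mxE eqxx /=.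
rewrite [X in _ + X]big1 ?addr0 => [|j /negPf nj]; last first.
  by rewrite [X in _ * X]mxE nj mulr0.
rewrite mxE (bigD1 y) //= [delta_mx x y a y]mxE eqxx andbT.
rewrite [X in (_ + X) * _]big1 ?addr0 => [|j /negPf nj]; last first.
  by rewrite [delta_mx x y a j]mxE nj andbF mul0r.
by rewrite !mxE mulrAC -natrM mulnb mulrC.
Qed.

Lemma wtr_mul_cdelta i x y z : B z ->
  tau (z *m (P i *m delta_mx x y *m P i)) = s i * (P i *m z *m P i) y x.
Proof.
move=> Bz; have -> : z *m (P i *m delta_mx x y *m P i) =
   P i *m (z *m P i *m delta_mx x y) *m P i.
  by rewrite !mulmxA memB_comm // -[z *m P i *m P i]mulmxA P_idem.
by rewrite wtr_corner !mulmxA tr_delta_mul.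
Qed.

Lemma dual_basis_ybasis z : B z -> \sum_l tau (z *m xbasis l) *: ybasis l = z.
Proof.
move=> Bz; rewrite -(pair_bigA _ (fun i p => tau (z *m xbasis (i, p)) *: ybasis (i, p))) /=.
rewrite [RHS]((B_def z).1 Bz); apply: eq_bigr => i _.
transitivity (P i *m (P i *m z *m P i) *m P i); last first.
  by rewrite !mulmxA P_idem -mulmxA P_idem.
rewrite [P i *m z *m P i]matrix_sum_delta exchange_big pair_bigA /=.
rewrite mulmx_sumr mulmx_suml; apply: eq_bigr => -[x y] _ /=.
rewrite /xbasis /ybasis /= wtr_mul_cdelta // scalerA mulrAC mulfV ?gt_eqF // mul1r.
by rewrite -scalemxAr -scalemxAl.
Qed.

Lemma dual_basis_xbasis z : B z -> \sum_l tau (z *m ybasis l) *: xbasis l = z.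
Proof.
move=> Bz; rewrite -[RHS](dual_basis_ybasis Bz).
pose f (l : I * ('I_N * 'I_N)) := (l.1, (l.2.2, l.2.1)).
rewrite (reindex_inj (h := f)) /=; last by apply: can_inj (f) _ => -[? []].
apply: eq_bigr => l _; rewrite /xbasis /ybasis /=.
by rewrite -scalemxAr wtrZ scalerA mulrC.
Qed.

(** In each summand, [delta_mx x y *m w *m delta_mx y x] is [w y y] times [delta_mx x x]: summing
    over [y] produces a trace and summing over [x] the identity. *)
Lemma casimir z : \sum_l xbasis l *m z *m ybasis l = \sum_i ((s i)^-1 * \tr (P i *m z)) *: P i.
Proof.
rewrite -(pair_bigA _ (fun i p => xbasis (i, p) *m z *m ybasis (i, p))) /=.
apply: eq_bigr => i _; rewrite -(pair_bigA _ (fun x y => xbasis (i, (x, y)) *m z *m ybasis (i, (x, y)))) /=.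
have H x y : xbasis (i, (x, y)) *m z *m ybasis (i, (x, y)) =
   ((s i)^-1 * (P i *m z *m P i) y y) *: (P i *m delta_mx x x *m P i).
  rewrite /xbasis /ybasis /= -scalemxAr -scalerA; congr (_ *: _).
  have -> : P i *m delta_mx x y *m P i *m z *m (P i *m delta_mx y x *m P i) =
    P i *m (delta_mx x y *m (P i *m z *m P i) *m delta_mx y x) *m P i.
    by rewrite !mulmxA.
  rewrite scalemxAl scalemxAr; congr (_ *m _ *m _).
  exact: delta_sandwich.
under eq_bigr do under eq_bigr do rewrite H.
under eq_bigr do rewrite -scaler_suml.
rewrite -scaler_sumr -mulmx_suml -mulmx_sumr.
have -> : \sum_x delta_mx x x = 1%:M :> 'M[C]_N.
  rewrite -diag_const_mx diag_mx_sum_delta; apply: eq_bigr => x _; by rewrite mxE scale1r.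
rewrite mulmx1 P_idem -mulr_sumr; congr ((_ * _) *: _).
by rewrite -/(\tr _) mxtrace_mulC mulmxA P_idem.
Qed.

(** * Conditional expectations onto a subalgebra: density, index and the index bound *)

Section Subalgebra.
Variables (A : 'M[C]_N -> Prop) (K : finType) (a_ b_ : K -> 'M[C]_N) (R : 'M[C]_N).
Hypothesis A_sub : forall y, A y -> B y.
Hypothesis A_lin : forall (c : C) y z, A y -> A z -> A (c *: y + z).
Hypothesis A_mul : forall y z, A y -> A z -> A (y *m z).
Hypothesis A_adj : forall y, A y -> A (adj y).
Hypothesis A_unit : A e.
Hypothesis a_mem : forall p, A (a_ p).
Hypothesis b_mem : forall p, A (b_ p).
Hypothesis dual_a : forall y, A y -> \sum_p tau (b_ p *m y) *: a_ p = y.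
Hypothesis dual_b : forall y, A y -> \sum_p tau (a_ p *m y) *: b_ p = y.
Hypothesis R_mem : A R.
Local Notation T := (R *m adj R).
Hypothesis aTb : \sum_p a_ p *m T *m b_ p = e.
Hypothesis bTa : \sum_p b_ p *m T *m a_ p = e.

(** The tau-orthogonal projection onto [A] written in the dual frames [a_] and [b_]; it is the
    candidate for the tau-preserving expectation. *)
Definition expA (x : 'M[C]_N) : 'M[C]_N := \sum_p tau (b_ p *m x) *: a_ p.

Lemma T_mem : A T. Proof. by apply: A_mul => //; apply: A_adj. Qed.

Section Condexp.
Variable E : 'M[C]_N -> 'M[C]_N.
Hypothesis hE : condexp B A E.

Lemma condexp_mem x : B x -> A (E x). Proof. by case: hE => H _ _ _ _; apply: H. Qed.
Lemma condexp_memB x : B x -> B (E x). Proof. by move/condexp_mem/A_sub. Qed.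
Lemma condexp_id y : A y -> E y = y. Proof. by case: hE => _ H _ _ _; apply: H. Qed.
Lemma condexp_lin (c : C) x y : B x -> B y -> E (c *: x + y) = c *: E x + E y.
Proof. by case: hE => _ _ H _ _; apply: H. Qed.

Lemma condexp_mull y x : A y -> B x -> E (y *m x) = y *m E x.
Proof.
case: hE => _ _ _ H _ Ay Bx; have := H y e x Ay A_unit Bx.
have By := A_sub Ay; have BE := condexp_memB Bx.
by rewrite !memB_mul1r //; apply: memBM.
Qed.

Lemma condexp_mulr y x : A y -> B x -> E (x *m y) = E x *m y.
Proof.
case: hE => _ _ _ H _ Ay Bx; have := H e y x A_unit Ay Bx.
have BE := condexp_memB Bx.
by rewrite !memB_mul1l.
Qed.

Lemma condexp_comb (J : finType) (c : J -> C) (x : J -> 'M[C]_N) :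
  (forall j, B (x j)) -> E (\sum_j c j *: x j) = \sum_j c j *: E (x j).
Proof.
move=> Bx; pose rel u v := B u /\ E u = v.
(* Linearity of [E] is available only on [B], so membership of the partial sums is carried through
   the induction. *)
suff : rel (\sum_j c j *: x j) (\sum_j c j *: E (x j)) by case.
apply: (big_ind2 rel) => [|u v u' v' [Bu <-] [Bu' <-]|j _]; rewrite /rel.
- split; first exact: memB0.
  have := condexp_lin 1 memB0 memB0; rewrite !scale1r addr0 => /eqP.
  by rewrite eq_sym -subr_eq0 addrK => /eqP.
- by split; [exact: memBD | rewrite -[u]scale1r condexp_lin // !scale1r].
split; first exact: memBZ.
have := condexp_lin (c j) (Bx j) memB0; rewrite addr0 => ->.
have := condexp_lin 1 memB0 memB0; rewrite !scale1r addr0 => /eqP.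
by rewrite eq_sym -subr_eq0 addrK => /eqP ->; rewrite addr0.
Qed.

(** The Radon-Nikodym derivative of [tau \o E] with respect to tau, obtained by expanding in the
    dual frames. *)
Definition density : 'M[C]_N := \sum_l tau (E (xbasis l)) *: ybasis l.
Local Notation h := density.

Lemma memB_density : B h.
Proof. by apply: memB_sum => l; apply/memBZ/memB_ybasis. Qed.

Lemma wtr_density x : B x -> tau (h *m x) = tau (E x).
Proof.
move=> Bx; rewrite -{2}(dual_basis_xbasis Bx) condexp_comb; last by move=> l; apply: memB_xbasis.
rewrite /density mulmx_suml !wtr_sum; apply: eq_bigr => l _.
by rewrite -scalemxAl !wtrZ mulrC wtrC //; apply: memB_ybasis.
Qed.

(** Paired with [x], the two sides give the tau-values of [y *m E x] and [E x *m y] because [E] is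
    [A]-bimodular; these agree since tau is a trace. *)
Lemma density_comm y : A y -> h *m y = y *m h.
Proof.
move=> Ay; have By := A_sub Ay; have Bh := memB_density.
apply/eqP; rewrite -subr_eq0; apply/eqP/wtr_nondeg.
  by apply: memBB; apply: memBM.
move=> x Bx; rewrite mulmxBl wtrB -!mulmxA [tau (y *m _)]wtrC // -mulmxA.
rewrite !wtr_density; try exact: memBM.
rewrite condexp_mulr // condexp_mull // wtrC ?subrr //.
Qed.

Lemma density_ge0 x : B x -> 0 <= tau (h *m (x *m adj x)).
Proof.
move=> Bx; rewrite wtr_density; last by apply: memBM => //; apply: memB_adj.
case: hE => _ _ _ _ /(_ (x *m adj x)) [].
- by apply: memBM => //; apply: memB_adj.
- by exists (adj x); rewrite adjCK.
by move=> b ->; rewrite -{2}[b]adjCK wtr_mul_adj_ge0.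
Qed.

Lemma density_form x y (c : C) : B x -> B y ->
  tau (h *m ((x + c *: y) *m adj (x + c *: y))) =
  tau (h *m (x *m adj x)) + c^* * tau (h *m (x *m adj y))
  + c * tau (h *m (y *m adj x)) + `|c| ^+ 2 * tau (h *m (y *m adj y)).
Proof.
move=> Bx By; rewrite adj_add adj_scale mulmxDl !mulmxDr -!scalemxAr -!scalemxAl.
rewrite -!scalemxAr scalerA normCK !wtrD !wtrZ; ring.
Qed.

(** A functional that is nonnegative on all [x *m adj x] is hermitian: polarise against the unit. *)
Lemma density_adj : adj h = h.
Proof.
have Bh := memB_density; have Be := memB_wunit.
apply/eqP; rewrite -subr_eq0; apply/eqP/wtr_nondeg.
  by apply: memBB => //; apply: memB_adj.
move=> z Bz; rewrite mulmxBl wtrB; apply/eqP; rewrite subr_eq0; apply/eqP.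
have -> : tau (adj h *m z) = (tau (h *m adj z))^*.
  by rewrite -wtr_adj adj_mul adjCK wtrC //; apply: memB_adj.
have H c : 0 <= c^* * tau (h *m z) + c * tau (h *m adj z) +
    (tau (h *m (z *m adj z)) + `|c| ^+ 2 * tau (h *m (e *m adj e))).
  have := density_ge0 (memBD Bz (memBZ c Be)).
  rewrite density_form // adj_wunit memB_mul1r // memB_mul1l; last exact: memB_adj.
  by rewrite -!addrA addrC -!addrA [_ + tau _]addrC !addrA.
have H' c : c^* * tau (h *m z) + c * tau (h *m adj z) \is Num.real.
  have r : tau (h *m (z *m adj z)) + `|c| ^+ 2 * tau (h *m (e *m adj e)) \is Num.real.
    by apply: ger0_real; rewrite addr_ge0 ?density_ge0 // mulr_ge0 ?exprn_ge0 ?density_ge0.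
  by rewrite -(rpredDr _ r) ger0_real.
(* Reality of [u + v] and of ['i (v - u)] together force [u] to be the conjugate of [v]. *)
move: (H' 1) (H' 'i); set u := tau (h *m z); set v := tau (h *m adj z).
rewrite rmorph1 !mul1r conjCi => /CrealP; rewrite rmorphD /= => H1 /CrealP.
rewrite rmorphD !rmorphM rmorphN /= conjCi opprK => H2.
have {}H2 : u^* - v^* = v - u.
  apply: (mulfI (neq0Ci C)); rewrite !mulrBr -mulNr H2 mulNr addrC; ring.
have : 2 * u = 2 * v^*.
  have -> : 2 * u = (u + v) - (v - u) by ring.
  by rewrite -H1 -H2; ring.
have n2 : 2 != 0 :> C by rewrite pnatr_eq0.
by move/(mulfI n2).
Qed.

(** The equality case of Cauchy-Schwarz: a null vector of the positive form given by [h] is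
    orthogonal to everything, and tau is nondegenerate. *)
Lemma density_ker x : B x -> tau (h *m (x *m adj x)) = 0 -> h *m x = 0.
Proof.
move=> Bx x0; have Bh := memB_density; apply: wtr_nondeg; first exact: memBM.
move=> y By; rewrite -[y]adjCK; have {By}: B (adj y) by apply: memB_adj.
move: (adj y) => {}y By; rewrite -mulmxA.
apply: (@cross_term_eq0 _ _ (tau (h *m (y *m adj y)))); first exact: density_ge0.
move=> c; have := density_ge0 (memBD Bx (memBZ c By)).
rewrite density_form // x0 add0r -wtr_adj !adj_mul adjCK density_adj.
by rewrite [tau (_ *m h)]wtrC //; apply: memBM => //; apply: memB_adj.
Qed.

Lemma condexp_expand x : B x -> E x = \sum_p tau (h *m (b_ p *m x)) *: a_ p.
Proof.
move=> Bx; rewrite -[LHS]dual_a; last exact: condexp_mem.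
apply: eq_bigr => p _; rewrite -condexp_mull // wtr_density //.
by apply: memBM => //; apply: A_sub.
Qed.

Lemma density_unit_expA : h = e -> forall x, B x -> E x = expA x.
Proof.
move=> he x Bx; rewrite condexp_expand // he; apply: eq_bigr => p _.
by rewrite memB_mul1l //; apply: memBM => //; apply: A_sub.
Qed.

Lemma wtr_preserving_density : (forall x, B x -> tau (E x) = tau x) -> h = e.
Proof.
move=> H; apply/eqP; rewrite -subr_eq0; apply/eqP/wtr_nondeg.
  exact/memBB/memB_wunit/memB_density.
by move=> x Bx; rewrite mulmxBl wtrB wtr_density // H // memB_mul1l // subrr.
Qed.

Section Index.
Variable us : seq ('M[C]_N * 'M[C]_N).
Hypothesis us_mem : forall uv, uv \in us -> B uv.1 /\ B uv.2.
Hypothesis us_basis : forall x, B x -> x = \sum_(uv <- us) uv.1 *m E (uv.2 *m x).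

(** A quasi-basis recovers [x] from the elements [E (v *m x)], whose coefficients are tau-values
    containing the factor [x *m h] after a cyclic permutation. *)
Lemma density_mulr_eq0 x : B x -> x *m h = 0 -> x = 0.
Proof.
move=> Bx xh; rewrite (us_basis Bx) big1_seq // => uv /andP[_ /us_mem [_ Bv]].
rewrite condexp_expand; last exact: memBM.
rewrite big1 ?mulmx0 // => p _; have Bb := A_sub (b_mem p).
by rewrite wtrC; [rewrite -!mulmxA xh !mulmx0 wtr0 scale0r | exact: memB_density].
Qed.

(** Adding the complementary projection [1%:M - e] turns [h] into an invertible matrix of full size;
    its inverse is then cut back to [B]. *)
Lemma density_inv : exists g, [/\ B g, g *m h = e & h *m g = e].
Proof.
have Bh := memB_density; have Be := memB_wunit.
pose h' := h + (1%:M - e).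
have h'e : h' *m e = h.
  by rewrite mulmxDl mulmxBl mul1mx !memB_mul1r // subrr addr0.
have eh' : e *m h' = h.
  by rewrite mulmxDr mulmxBr mulmx1 !memB_mul1l // subrr addr0.
have h'P i : P i *m h' = h' *m P i.
  rewrite mulmxDl mulmxDr mulmxBl mulmxBr mul1mx mulmx1.
  by rewrite !(memB_comm i).
have uh : h' \in unitmx.
  rewrite -row_free_unit -kermx_eq0; apply/eqP; move: (kermx h') (mulmx_ker h') => k kh'.
  have kh : k *m h = 0 by rewrite -h'e mulmxA kh' mul0mx.
  have ke : k = k *m e.
    move: kh'; rewrite mulmxDr kh add0r mulmxBr mulmx1 => /eqP.
    by rewrite subr_eq0 => /eqP.
  rewrite ke /wunit mulmx_sumr big1 // => i _.
  (* The kernel matrix [k] need not lie in [B], but the compressions of [adj k *m k] do, and [h]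
     annihilates them as well. *)
  have x0 : P i *m (adj k *m k) *m P i = 0.
    apply: density_mulr_eq0; first exact: memB_corner.
    by rewrite -mulmxA (memB_comm i Bh) !mulmxA -(mulmxA _ k h) kh mulmx0 mul0mx.
  apply: (can_inj (@adjCK C N)); rewrite adj_zero; apply: tr_mul_adj_eq0.
  by rewrite adjCK adj_mul P_adj mulmxA -(mulmxA (P i)) x0 mxtrace0.
exists (e *m invmx h'); split.
- apply: corner_mem => [i|]; last by rewrite mulmxA memB_mul1l.
  rewrite mulmxA (memB_comm i Be) -!mulmxA; congr (_ *m _).
  by rewrite -[LHS](mulKmx uh) [h' *m _]mulmxA -h'P -mulmxA mulmxV // mulmx1.
- by rewrite -mulmxA -h'e mulKmx // memB_mul1r.
by rewrite mulmxA memB_mul1r // -eh' mulmxK.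
Qed.

(* Both sides arise from [\sum_l xbasis l *m (T *m g) *m ybasis l] after
   expanding [xbasis l] in the quasi-basis [us]. *)
Lemma index_casimir g : B g -> g *m h = e ->
  \sum_(uv <- us) uv.1 *m uv.2 = \sum_i ((s i)^-1 * \tr (P i *m (T *m g))) *: P i.
Proof.
move=> Bg gh; rewrite -casimir; have Bh := memB_density.
transitivity (\sum_l \sum_(uv <- us) \sum_p
   tau (h *m (b_ p *m (uv.2 *m xbasis l))) *: (uv.1 *m a_ p *m (T *m g) *m ybasis l)).
  rewrite exchange_big; apply: eq_big_seq => uv /us_mem [Bu Bv].
  rewrite -{1}[uv.2]memB_mul1l // -aTb mulmx_suml mulmx_sumr exchange_big.
  apply: eq_bigr => p _; have Bb := A_sub (b_mem p).
  have Bz : B (h *m (b_ p *m uv.2)) by do !apply: memBM.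
  have -> : \sum_l tau (h *m (b_ p *m (uv.2 *m xbasis l))) *: (uv.1 *m a_ p *m (T *m g) *m ybasis l)
    = uv.1 *m a_ p *m (T *m g) *m (\sum_l tau (h *m (b_ p *m uv.2) *m xbasis l) *: ybasis l).
    by rewrite mulmx_sumr; apply: eq_bigr => l _; rewrite -[RHS]scalemxAr !mulmxA.
  rewrite dual_basis_ybasis // !mulmxA -(mulmxA _ g h) gh.
  by rewrite -(mulmxA _ _ e) memB_mul1r //; apply/memB_adj/A_sub.
apply: eq_bigr => l _; rewrite {2}(us_basis (memB_xbasis l)) mulmx_suml mulmx_suml.
apply: eq_big_seq => uv /us_mem [Bu Bv].
rewrite condexp_expand; last by apply: memBM => //; apply: memB_xbasis.
rewrite mulmx_sumr !mulmx_suml; apply: eq_bigr => p _.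
by rewrite -[uv.1 *m (_ *: _)]scalemxAr -!scalemxAl.
Qed.

(** Since [h *m g = e], the product [h *m (x *m adj x)] collapses to [(h - e) *m T *m (e - g)]. On
    expanding, [tau (h *m T) = tau T] because [E] fixes [T], and the term in [h *m T *m g] is
    [tau T] by traciality. *)
Lemma wtr_index_gap g : B g -> g *m h = e -> h *m g = e ->
  let x := g *m (h - e) *m R in tau (h *m (x *m adj x)) = tau (T *m g) - tau T.
Proof.
move=> Bg gh hg x; have Bh := memB_density; have Be := memB_wunit.
have BT := A_sub T_mem; have BR := A_sub R_mem.
have ag : adj g = g.
  rewrite -[LHS]memB_mul1r; last exact: memB_adj.
  by rewrite -hg mulmxA -density_adj -adj_mul hg adj_wunit memB_mul1l.
have -> : h *m (x *m adj x) = h *m g *m (h - e) *m T *m ((h - e) *m g).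
  by rewrite /x !adj_mul ag adj_add adj_opp density_adj adj_wunit !mulmxA.
rewrite hg memB_mul1l; last exact: memBB.
have -> : (h - e) *m g = e - g by rewrite mulmxBl hg memB_mul1l.
rewrite mulmxBl memB_mul1l // mulmxBl !mulmxBr !wtrB !memB_mul1r //; last exact: memBM.
rewrite wtr_density // condexp_id; last exact: T_mem.
rewrite -mulmxA [tau (h *m _)]wtrC // -[T *m g *m h]mulmxA gh memB_mul1r // subrr add0r.
by rewrite opprB.
Qed.

(** A zero gap gives a null vector of the form of [h], hence [(h - e) *m R = 0]. Invertibility of
    [R] is replaced by the identity [aTb]: [h - e] commutes with each [a_ p], so it can be moved
    next to [R]. *)
Lemma density_rigid g : B g -> g *m h = e -> h *m g = e ->
  tau (T *m g) = tau T -> h = e.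
Proof.
move=> Bg gh hg eqT; have Bh := memB_density; have Be := memB_wunit.
have BR := A_sub R_mem; have Bhe : B (h - e) by apply: memBB.
have Bx : B (g *m (h - e) *m R) by do !apply: memBM.
have /(density_ker Bx) : tau (h *m (g *m (h - e) *m R *m adj (g *m (h - e) *m R))) = 0.
  by rewrite wtr_index_gap // eqT subrr.
rewrite !mulmxA hg memB_mul1l // => hR.
apply/eqP; rewrite -subr_eq0; apply/eqP.
rewrite -(memB_mul1r Bhe) -[X in _ *m X]aTb mulmx_sumr big1 // => p _.
have -> : (h - e) *m (a_ p *m T *m b_ p) = a_ p *m ((h - e) *m R) *m (adj R *m b_ p).
  have /A_sub Ba := a_mem p.
  have ah : a_ p *m (h - e) = (h - e) *m a_ p.
    by rewrite mulmxBr mulmxBl density_comm // memB_mul1r // memB_mul1l.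
  by rewrite !mulmxA -ah.
by rewrite hR mulmx0 mul0mx.
Qed.

End Index.
End Condexp.

(** The weights [s i ^+ 2] are chosen so that the weighted sum of the index entries is
    [tau (T *m g)]; the gap formula compares it with [tau T], and the rigidity of the density
    settles equality. *)
Theorem condexp_index_bound E X : condexp B A E -> is_index B E X ->
  exists c : I -> C, [/\ X = \sum_i c i *: P i,
    tau T <= \sum_i s i ^+ 2 * c i &
    (\sum_i s i ^+ 2 * c i = tau T -> forall x, B x -> E x = expA x)].
Proof.
move=> hE [us [us_mem [us_basis ->]]].
have basis x : B x -> x = \sum_(uv <- us) uv.1 *m E (uv.2 *m x).
  by move=> /us_basis [].
have [g [Bg gh hg]] := density_inv hE us_mem basis.
exists (fun i => (s i)^-1 * \tr (P i *m (T *m g))).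
have -> : \sum_i s i ^+ 2 * ((s i)^-1 * \tr (P i *m (T *m g))) = tau (T *m g).
  apply: eq_bigr => i _; rewrite mulrA expr2 mulfK // gt_eqF //.
split; first exact: (index_casimir hE us_mem basis Bg gh).
  rewrite -subr_ge0 -(wtr_index_gap hE Bg gh hg) density_ge0 //.
  do !apply: memBM => //; last exact: A_sub.
  exact/memBB/memB_wunit/memB_density.
by move=> /(density_rigid hE Bg gh hg) /(density_unit_expA hE).
Qed.

Lemma wtr_preserving_expA E : condexp B A E -> (forall x, B x -> tau (E x) = tau x) ->
  forall x, B x -> E x = expA x.
Proof. by move=> hE /(wtr_preserving_density hE) /(density_unit_expA hE). Qed.

Lemma wtr_preserving_index E X : condexp B A E ->
  (forall x, B x -> tau (E x) = tau x) -> is_index B E X ->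
  X = \sum_i ((s i)^-1 * \tr (P i *m T)) *: P i.
Proof.
move=> hE pE [us [us_mem [us_basis ->]]].
have basis x : B x -> x = \sum_(uv <- us) uv.1 *m E (uv.2 *m x).
  by move=> /us_basis [].
have he := wtr_preserving_density hE pE; have Be := memB_wunit.
rewrite (index_casimir hE us_mem basis (g := e)) ?he ?memB_mul1r //.
exact/A_sub/T_mem.
Qed.

(** The pairs [(xbasis l, T *m ybasis l)] form a quasi-basis. For the left expansion, insert [e] in
    the form [bTa] to the right of [x] and expand [x *m b_ p *m T] in the frame; for the right one,
    use [aTb] on the left. The index is then a Casimir sum. *)
Lemma index_expA E : (forall x, B x -> E x = expA x) ->
  is_index B E (\sum_i ((s i)^-1 * \tr (P i *m T)) *: P i).
Proof.
move=> hE; exists [seq (xbasis l, T *m ybasis l) | l : (I * ('I_N * 'I_N))%type].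
have BR := A_sub R_mem; have BR' := memB_adj BR.
have BT := A_sub T_mem.
split; [|split].
- move=> uv /mapP [l _ ->] /=; split; first exact: memB_xbasis.
  by apply: memBM => //; apply: memB_ybasis.
- move=> x Bx; rewrite !big_image /=; split.
    rewrite -[LHS]memB_mul1r // -bTa mulmx_sumr.
    transitivity (\sum_p \sum_l tau (x *m b_ p *m T *m ybasis l) *: (xbasis l *m a_ p)).
      apply: eq_bigr => p _; have Bb := A_sub (b_mem p).
      rewrite !(mulmxA x) -{1}(@dual_basis_xbasis (x *m b_ p *m T)) ?mulmx_suml.
        by apply: eq_bigr => l _; rewrite -scalemxAl.
      by do !apply: memBM.
    rewrite exchange_big; apply: eq_bigr => l _ /=.
    have Bl := memB_ybasis l.
    rewrite hE; last by do !apply: memBM.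
    rewrite mulmx_sumr; apply: eq_bigr => p _; have Bb := A_sub (b_mem p).
    rewrite -[RHS]scalemxAr; congr (_ *: _).
    by rewrite -!(mulmxA x) wtrC ?mulmxA.
  rewrite -[LHS]memB_mul1l // -aTb mulmx_suml.
  transitivity (\sum_p \sum_l tau (b_ p *m x *m xbasis l) *: (a_ p *m T *m ybasis l)).
    apply: eq_bigr => p _; have Bb := A_sub (b_mem p).
    rewrite -(mulmxA _ (b_ p)) -{1}(@dual_basis_ybasis (b_ p *m x)) ?mulmx_sumr.
      by apply: eq_bigr => l _; rewrite -[LHS]scalemxAr.
    exact: memBM.
  rewrite exchange_big; apply: eq_bigr => l _ /=.
  have Bl := memB_xbasis l.
  rewrite hE; last exact: memBM.
  rewrite mulmx_suml; apply: eq_bigr => p _.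
  by rewrite -[RHS]scalemxAl !mulmxA.
by rewrite big_image -casimir; apply: eq_bigr => l _; rewrite !mulmxA.
Qed.

Lemma wtr_expA y x : A y -> B x -> tau (y *m expA x) = tau (y *m x).
Proof.
move=> Ay Bx; have By := A_sub Ay.
rewrite /expA mulmx_sumr wtr_sum -{2}(dual_b Ay) mulmx_suml wtr_sum.
apply: eq_bigr => p _; rewrite -scalemxAr -scalemxAl !wtrZ.
by rewrite mulrC [tau (y *m _)]wtrC.
Qed.

Lemma expA_mem x : A (expA x).
Proof.
have A0 : A 0.
  by have := A_lin (- 1) A_unit A_unit; rewrite scaleN1r addNr.
apply: (big_ind A) => // [y z Ay Az | p _].
  by rewrite -[y]scale1r; apply: A_lin.
by rewrite -[_ *: _]addr0; apply: A_lin.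
Qed.

Lemma condexp_expA : (forall x, B x -> psd x -> psd (expA x)) -> condexp B A expA.
Proof.
move=> pos; split => // [x _|c x y Bx By|y z x Ay Az Bx].
- exact: expA_mem.
- rewrite /expA scaler_sumr -big_split /=; apply: eq_bigr => p _.
  by rewrite mulmxDr -scalemxAr wtr_lin scalerDl scalerA.
have By := A_sub Ay; have Bz := A_sub Az; have Be := A_sub (expA_mem x).
rewrite -[RHS]dual_a; last by do !apply: A_mul => //; apply: expA_mem.
apply: eq_bigr => p _; have Bb := A_sub (b_mem p); congr (_ *: _).
rewrite !mulmxA [RHS]wtrC; last by do !apply: memBM.
rewrite [LHS]wtrC; last by do !apply: memBM.
by rewrite !mulmxA wtr_expA //; do !apply: A_mul.
Qed.

End Subalgebra.
End Multimatrix.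

(** * Representations by matrix units *)

Section Blocks.
Variables (C : numClosedFieldType) (p : nat) (k : 'I_p -> nat).
Local Notation Nk := (\sum_j k j)%N.
Local Notation bl := (@tagnat.sig1 p k).
Implicit Types (x y : 'M[C]_Nk) (r c : 'I_Nk).

Lemma mxdiag_submxblock x r c :
  (\mxdiag_i submxblock x i i) r c = if bl r == bl c then x r c else 0.
Proof.
(* Blocks with different indices have different types; stating the entry for arbitrary [i] and [j]
   lets the equality be destructed, so that [conform_mx] disappears. *)
have H i j (a : 'I_(k i)) (b : 'I_(k j)) :
    (if i == j then conform_mx 0 (submxblock x i i) else 0) a b =
    if i == j then x (tagnat.Rank i a) (tagnat.Rank j b) else 0.
  case: eqP => [e|_]; last by rewrite mxE.
  by case: j / e b => b; rewrite conform_mx_id mxE.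
by rewrite mxE H !tagnat.sig2K.
Qed.

Lemma blockdiagP x : blockdiag k x <-> forall r c, bl r != bl c -> x r c = 0.
Proof.
split=> [-> r c /negPf ne|H]; first by rewrite mxdiag_submxblock ne.
apply/matrixP => r c; rewrite mxdiag_submxblock; case: eqVneq => // /H //.
Qed.

Lemma sum_blocks (V : nmodType) (F : 'I_p -> V) : \sum_r F (bl r) = \sum_j F j *+ k j.
Proof.
transitivity (\sum_j \sum_(a < k j) F j); last first.
  by apply: eq_bigr => j _; rewrite sumr_const card_ord.
by rewrite sig_big_dep /= (reindex _ tagnat.sig_bij_on).
Qed.

Lemma blockunitE j : blockunit C k j = \matrix_(r, c) ((r == c) && (bl r == j))%:R.
Proof.
have bX : blockdiag k (\matrix_(r, c) ((r == c) && (bl r == j))%:R : 'M[C]_Nk).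
  apply/blockdiagP => r c ne; rewrite mxE; by case: (r =P c) ne => [->|//]; rewrite eqxx.
rewrite [RHS]bX; apply: eq_mxdiag => i; apply/matrixP => a b.
rewrite 2!mxE -(val_eqE (tagnat.Rank i a)) /= tagnat.eq_Rank eqxx /= tagnat.Rank1K.
by case: (i == j); rewrite mxE ?andbT ?andbF.
Qed.

Variable k_gt0 : forall j, (0 < k j)%N.
Definition first j : 'I_Nk := tagnat.Rank j (Ordinal (k_gt0 j)).

Lemma bl_first j : bl (first j) = j. Proof. exact: tagnat.Rank1K. Qed.

Lemma minprojE j : minproj C k j = delta_mx (first j) (first j).
Proof.
have bX : blockdiag k (delta_mx (first j) (first j) : 'M[C]_Nk).
  apply/blockdiagP => r c ne; rewrite mxE.
  by case: (r =P _) ne => [->|//]; case: (c =P _) => [->|//]; rewrite eqxx.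
rewrite [RHS]bX; apply: eq_mxdiag => i; apply/matrixP => a b.
rewrite 2!mxE -(val_eqE (tagnat.Rank i a)) -(val_eqE (tagnat.Rank i b)) /= !tagnat.eq_Rank /=.
case: (i == j) => //=; rewrite !mxE //=.
by case: (nat_of_ord a) (nat_of_ord b) => [|u] [|w] //=; rewrite ?andbF.
Qed.

(** Taking the value 0 across blocks lets sums run over all pairs of indices instead of dependent
    pairs inside a block. *)
Definition dlt r c : 'M[C]_Nk := if bl r == bl c then delta_mx r c else 0.

Lemma dltE r c : bl r = bl c -> dlt r c = delta_mx r c.
Proof. by rewrite /dlt => ->; rewrite eqxx. Qed.

Lemma dlt0 r c : bl r != bl c -> dlt r c = 0.
Proof. by rewrite /dlt => /negPf ->. Qed.

Lemma blockdiag0 : blockdiag k (0 : 'M[C]_Nk).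
Proof. by apply/blockdiagP => r c _; rewrite mxE. Qed.

Lemma blockdiag_lin (a : C) x y :
  blockdiag k x -> blockdiag k y -> blockdiag k (a *: x + y).
Proof.
move=> /blockdiagP bx /blockdiagP b_y; apply/blockdiagP => r c ne.
by rewrite !mxE bx // b_y // mulr0 addr0.
Qed.

Lemma blockdiagM x y : blockdiag k x -> blockdiag k y -> blockdiag k (x *m y).
Proof.
move=> /blockdiagP bx /blockdiagP b_y; apply/blockdiagP => r c ne.
rewrite mxE big1 // => i _; have [e|ne'] := eqVneq (bl r) (bl i).
  by rewrite b_y ?mulr0 // -e.
by rewrite bx ?mul0r.
Qed.

Lemma blockdiag_adj x : blockdiag k x -> blockdiag k (adj x).
Proof.
move=> /blockdiagP bx; apply/blockdiagP => r c ne.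
by rewrite !mxE bx ?rmorph0 // eq_sym.
Qed.

Lemma blockdiag_dlt r c : blockdiag k (dlt r c).
Proof.
apply/blockdiagP => r' c' ne; rewrite /dlt; case: eqP => [e|_]; rewrite mxE //.
by case: (r' =P r) ne => [->|//]; case: (c' =P c) => [->|//]; rewrite e eqxx.
Qed.

Lemma blockdiag_unit j : blockdiag k (blockunit C k j).
Proof.
rewrite blockunitE; apply/blockdiagP => r c ne; rewrite mxE.
by case: (r =P c) ne => [->|//]; rewrite eqxx.
Qed.

Lemma blockdiag_scalar (a : C) : blockdiag k (a%:M : 'M[C]_Nk).
Proof.
apply/blockdiagP => r c ne; rewrite mxE.
by case: (r =P c) ne => [->|//]; rewrite eqxx.
Qed.

Lemma adj_dlt r c : adj (dlt r c) = dlt c r.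
Proof.
rewrite /dlt eq_sym; case: eqP => _; last exact: adj_zero.
by rewrite /adj map_delta_mx trmx_delta.
Qed.

Lemma blockdiag_expand x : blockdiag k x -> x = \sum_r \sum_c x r c *: dlt r c.
Proof.
move=> /blockdiagP bx; rewrite {1}[x]matrix_sum_delta.
apply: eq_bigr => r _; apply: eq_bigr => c _.
have [e|ne] := eqVneq (bl r) (bl c); first by rewrite dltE.
by rewrite bx // !scale0r.
Qed.

Lemma mul_dlt r c r' c' : bl r = bl c ->
  dlt r c *m dlt r' c' = if c == r' then dlt r c' else 0.
Proof.
move=> e; rewrite dltE //; have [e'|ne] := eqVneq (bl r') (bl c').
  rewrite dltE // mul_delta_mx_cond; case: eqP => [cr|_] //.
  by rewrite mulr1n dltE // e cr.
by rewrite (dlt0 ne) mulmx0; case: eqP => // cr; rewrite dlt0 // e cr.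
Qed.

(** * The image of a block algebra under a star homomorphism, with its dual frames and
    trace-preserving expectation *)

Section Representation.
Variables (N : nat) (I : finType) (P : I -> 'M[C]_N) (s : I -> C) (B : 'M[C]_N -> Prop).
Hypothesis P_adj : forall i, adj (P i) = P i.
Hypothesis P_mul : forall i i', P i *m P i' = if i == i' then P i else 0.
Hypothesis s_gt0 : forall i, 0 < s i.
Hypothesis B_def : forall x : 'M[C]_N, B x <-> x = \sum_i P i *m x *m P i.
Variables (psi : 'M[C]_Nk -> 'M[C]_N) (A : 'M[C]_N -> Prop).
Hypothesis psi_mem : forall x, blockdiag k x -> B (psi x).
Hypothesis psi_lin : forall (a : C) x y, blockdiag k x -> blockdiag k y ->
  psi (a *: x + y) = a *: psi x + psi y.
Hypothesis psi_mul : forall x y, blockdiag k x -> blockdiag k y ->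
  psi (x *m y) = psi x *m psi y.
Hypothesis psi_adj : forall x, blockdiag k x -> psi (adj x) = adj (psi x).
Hypothesis psi_unit : psi 1%:M = wunit P.
Hypothesis A_def : forall y : 'M[C]_N, A y <-> exists x, blockdiag k x /\ y = psi x.
Local Notation tau := (wtr P s).
Local Notation e := (wunit P).

Definition munit r c : 'M[C]_N := psi (dlt r c).
Local Notation F := munit.
Definition wt r : C := tau (F r r).

Lemma psi0 : psi 0 = 0.
Proof.
have := psi_lin 1 blockdiag0 blockdiag0; rewrite !scale1r addr0 => /eqP.
by rewrite eq_sym -subr_eq0 addrK => /eqP.
Qed.

Lemma psi_comb (J : finType) (f : J -> C) (x : J -> 'M[C]_Nk) :
  (forall j, blockdiag k (x j)) ->
  blockdiag k (\sum_j f j *: x j) /\ psi (\sum_j f j *: x j) = \sum_j f j *: psi (x j).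
Proof.
move=> bx; pose rel u v := blockdiag k u /\ psi u = v.
apply: (big_ind2 rel) => [|u v u' v' [bu <-] [bu' <-]|j _]; rewrite /rel.
- by split; [exact: blockdiag0 | exact: psi0].
- split; first by rewrite -[u]scale1r; apply: blockdiag_lin.
  by rewrite -[X in psi (X + _)]scale1r psi_lin // scale1r.
split; first by rewrite -[_ *: _]addr0; apply: blockdiag_lin => //; apply: blockdiag0.
rewrite -[f j *: x j]addr0 psi_lin ?psi0 ?addr0 //; exact: blockdiag0.
Qed.

Lemma psi_expand x : blockdiag k x -> psi x = \sum_r \sum_c x r c *: F r c.
Proof.
move=> bx; rewrite {1}(blockdiag_expand bx) !pair_bigA /=.
have [_ ->] // := psi_comb (fun q => x q.1 q.2) (fun q => blockdiag_dlt q.1 q.2).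
Qed.

Lemma munit_memA r c : A (F r c).
Proof. by apply/A_def; exists (dlt r c); split=> //; apply: blockdiag_dlt. Qed.

Lemma munit_mem r c : B (F r c). Proof. exact/psi_mem/blockdiag_dlt. Qed.

Lemma munit0 r c : bl r != bl c -> F r c = 0.
Proof. by move=> ne; rewrite /F dlt0 // psi0. Qed.

Lemma mul_munit r c r' c' : bl r = bl c ->
  F r c *m F r' c' = if c == r' then F r c' else 0.
Proof.
move=> ebl; rewrite /F -psi_mul; try exact: blockdiag_dlt.
by rewrite mul_dlt //; case: eqP; rewrite ?psi0.
Qed.

Lemma adj_munit r c : adj (F r c) = F c r.
Proof. by rewrite /F -psi_adj ?adj_dlt //; apply: blockdiag_dlt. Qed.

Lemma wtr_munit r c : tau (F r c) = if r == c then wt r else 0.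
Proof.
case: eqVneq => [->//|ne]; have [ebl|nb] := eqVneq (bl r) (bl c); last first.
  by rewrite munit0 // wtr0.
have -> : F r c = F r r *m F r c by rewrite mul_munit // eqxx.
rewrite (wtrC s P_mul B_def _ (munit_mem r r)) // mul_munit // eq_sym (negPf ne) wtr0 //.
Qed.

Lemma wt_block r c : bl r = bl c -> wt r = wt c.
Proof.
move=> ebl; rewrite /wt; have -> : F r r = F r c *m F c r by rewrite mul_munit // eqxx.
by rewrite (wtrC s P_mul B_def _ (munit_mem r c)) // mul_munit // eqxx.
Qed.

Lemma munit_diag_psd r : F r r = F r r *m adj (F r r).
Proof. by rewrite adj_munit mul_munit // eqxx. Qed.

Lemma wt_ge0 r : 0 <= wt r.
Proof. by rewrite /wt munit_diag_psd (wtr_mul_adj_ge0 P_adj P_mul s_gt0). Qed.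

(** [psi] may kill summands. By faithfulness of tau a zero weight occurs only there, so divisions by
    weights below are harmless. *)
Lemma wt_eq0 r c : wt r = 0 -> F r c = 0.
Proof.
have [ebl|nb] := eqVneq (bl r) (bl c); last by rewrite munit0.
rewrite /wt munit_diag_psd => /(wtr_mul_adj_eq0 P_adj P_mul s_gt0 B_def (munit_mem r r)) F0.
have -> : F r c = F r r *m F r c by rewrite mul_munit // eqxx.
by rewrite F0 mul0mx.
Qed.

Lemma sum_munit : \sum_r F r r = e.
Proof.
rewrite -psi_unit (psi_expand (blockdiag_scalar 1)); apply: eq_bigr => r _.
rewrite (bigD1 r) //= [X in _ + X]big1 ?addr0 => [|c /negPf ne].
  by rewrite mxE eqxx scale1r.
by rewrite mxE eq_sym ne scale0r.
Qed.

Definition mu_a (q : 'I_Nk * 'I_Nk) := F q.1 q.2.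
(** When the weight is 0, the convention [0^-1 = 0] agrees with the vanishing of the matrix unit. *)
Definition mu_b (q : 'I_Nk * 'I_Nk) := (wt q.1)^-1 *: F q.2 q.1.
(** A square root of [T], the central element with value [tau (f_j) / k_j] on the j-th summand.
    Having [T] in the form [R *m adj R] makes the gap in the index manifestly nonnegative. *)
Definition mu_R := \sum_r sqrtC (wt r / (k (bl r))%:R) *: F r r.

Lemma A_lin_closed (a : C) (y z : 'M[C]_N) : A y -> A z -> A (a *: y + z).
Proof.
move=> /A_def [x [bx ->]] /A_def [x' [bx' ->]]; apply/A_def.
by exists (a *: x + x'); rewrite psi_lin //; split=> //; apply: blockdiag_lin.
Qed.

Lemma A_mul_closed (y z : 'M[C]_N) : A y -> A z -> A (y *m z).
Proof.
move=> /A_def [x [bx ->]] /A_def [x' [bx' ->]]; apply/A_def.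
by exists (x *m x'); rewrite psi_mul //; split=> //; apply: blockdiagM.
Qed.

Lemma A_adj_closed (y : 'M[C]_N) : A y -> A (adj y).
Proof.
move=> /A_def [x [bx ->]]; apply/A_def.
by exists (adj x); rewrite psi_adj //; split=> //; apply: blockdiag_adj.
Qed.

Lemma A_wunit : A e.
Proof. by apply/A_def; exists 1%:M; split; [exact: blockdiag_scalar|]. Qed.

Lemma A_subB (y : 'M[C]_N) : A y -> B y.
Proof. by move=> /A_def [x [bx ->]]; apply: psi_mem. Qed.

Lemma A0 : A 0.
Proof. by apply/A_def; exists 0; rewrite psi0; split=> //; apply: blockdiag0. Qed.

Lemma A_scale (a : C) (y : 'M[C]_N) : A y -> A (a *: y).
Proof. by move=> Ay; rewrite -[_ *: _]addr0; apply: A_lin_closed => //; apply: A0. Qed.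

Lemma mu_a_mem q : A (mu_a q). Proof. exact: munit_memA. Qed.
Lemma mu_b_mem q : A (mu_b q). Proof. exact/A_scale/munit_memA. Qed.

Lemma mu_R_mem : A mu_R.
Proof.
apply: (big_ind A) => [||r _]; [exact: A0| |exact/A_scale/munit_memA].
by move=> y z Ay Az; rewrite -[y]scale1r; apply: A_lin_closed.
Qed.

Lemma mu_T : mu_R *m adj mu_R = \sum_r (wt r / (k (bl r))%:R) *: F r r.
Proof.
rewrite /mu_R adj_sum mulmx_suml; apply: eq_bigr => r _.
rewrite mulmx_sumr (bigD1 r) //= [X in _ + X]big1 ?addr0 => [|c /negPf ne].
  rewrite adj_scale adj_munit -scalemxAl -scalemxAr scalerA mul_munit // eqxx.
  have w0 : 0 <= wt r / (k (bl r))%:R by rewrite divr_ge0 ?wt_ge0 ?ler0n.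
  by rewrite geC0_conj ?sqrtC_ge0 // -expr2 sqrtCK.
by rewrite adj_scale adj_munit -scalemxAl -scalemxAr mul_munit // eq_sym ne !scaler0.
Qed.

Lemma mul_mu_T r c : bl r = bl c ->
  F r c *m (mu_R *m adj mu_R) = (wt c / (k (bl c))%:R) *: F r c.
Proof.
move=> ebl; rewrite mu_T mulmx_sumr (bigD1 c) //= [X in _ + X]big1 ?addr0 => [|i /negPf ne].
  by rewrite -scalemxAr mul_munit // eqxx.
by rewrite -scalemxAr mul_munit // eq_sym ne scaler0.
Qed.

Lemma mu_dual_a (y : 'M[C]_N) : A y -> \sum_q tau (mu_b q *m y) *: mu_a q = y.
Proof.
move=> /A_def [x [bx ->]]; rewrite [RHS]psi_expand // pair_bigA /=.
apply: eq_bigr => -[r c] _; rewrite /mu_a /mu_b /=.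
have [ebl|nb] := eqVneq (bl r) (bl c); last by rewrite (munit0 nb) !scaler0.
have [w0|w0] := eqVneq (wt r) 0; first by rewrite (wt_eq0 _ w0) !scaler0.
congr (_ *: _); rewrite -scalemxAl wtrZ psi_expand // mulmx_sumr wtr_sum (bigD1 r) //=.
rewrite [X in _ + X]big1 ?addr0 => [|i /negPf ne]; last first.
  rewrite mulmx_sumr big1 ?wtr0 // => c' _.
  by rewrite -scalemxAr mul_munit // eq_sym ne scaler0.
rewrite mulmx_sumr wtr_sum (bigD1 c) //= [X in _ + X]big1 ?addr0 => [|i /negPf ne].
  rewrite -scalemxAr wtrZ mul_munit // eqxx wtr_munit eqxx.
  by rewrite (wt_block ebl) mulrCA mulVf ?mulr1 // -(wt_block ebl).
by rewrite -scalemxAr wtrZ mul_munit // eqxx wtr_munit eq_sym ne mulr0.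
Qed.

Lemma mu_dual_b (y : 'M[C]_N) : A y -> \sum_q tau (mu_a q *m y) *: mu_b q = y.
Proof.
move=> Ay; rewrite -[RHS](mu_dual_a Ay).
have swapK : cancel (fun q : 'I_Nk * 'I_Nk => (q.2, q.1)) (fun q => (q.2, q.1)) by case.
rewrite (reindex_inj (can_inj swapK)); apply: eq_bigr => -[r c] _.
rewrite /mu_a /mu_b /= -scalemxAl wtrZ scalerA mulrC.
have [ebl|nb] := eqVneq (bl r) (bl c); last by rewrite (munit0 nb) !scaler0.
by rewrite (wt_block ebl).
Qed.

Lemma wt_cancel r : (wt r)^-1 * wt r *: F r r = F r r.
Proof.
have [w0|w0] := eqVneq (wt r) 0; first by rewrite (wt_eq0 _ w0) !scaler0.
by rewrite mulVf // scale1r.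
Qed.

Lemma sum_block_inv r : \sum_(c | bl c == bl r) (k (bl r))%:R^-1 = 1 :> C.
Proof.
pose f j : C := if j == bl r then (k (bl r))%:R^-1 else 0.
rewrite big_mkcond (eq_bigr (fun c => f (bl c))) // sum_blocks (bigD1 (bl r)) //=.
rewrite /f eqxx big1 ?addr0 => [|j /negPf ->]; last by rewrite mul0rn.
by rewrite -[X in X = 1]mulr_natr mulVf // pnatr_eq0 -lt0n.
Qed.

(** For fixed [r], each of the [k (bl r)] indices [c] in the block of [r] contributes [F r r]
    divided by [k (bl r)], the weights cancelling since they are constant on blocks. *)
Lemma mu_aTb : \sum_q mu_a q *m (mu_R *m adj mu_R) *m mu_b q = e.
Proof.
rewrite -sum_munit -(pair_bigA _ (fun r c => mu_a (r, c) *m (mu_R *m adj mu_R) *m mu_b (r, c))) /=.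
apply: eq_bigr => r _; rewrite -[RHS]scale1r -(sum_block_inv r) scaler_suml.
rewrite [RHS]big_mkcond; apply: eq_bigr => c _; rewrite /mu_a /mu_b /=.
case: eqVneq => [ebl|nb]; last by rewrite munit0 ?mul0mx // eq_sym.
rewrite mul_mu_T // -scalemxAl -scalemxAr mul_munit // eqxx scalerA.
by rewrite -{2}(wt_cancel r) scalerA ebl (wt_block ebl); congr (_ *: _); ring.
Qed.

Lemma mu_bTa : \sum_q mu_b q *m (mu_R *m adj mu_R) *m mu_a q = e.
Proof.
rewrite -sum_munit -(pair_bigA _ (fun r c => mu_b (r, c) *m (mu_R *m adj mu_R) *m mu_a (r, c))) /=.
rewrite exchange_big /=.
apply: eq_bigr => r _; rewrite -[RHS]scale1r -(sum_block_inv r) scaler_suml.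
rewrite [RHS]big_mkcond; apply: eq_bigr => c _; rewrite /mu_a /mu_b /=.
case: eqVneq => [ebl|nb]; last by rewrite (munit0 nb) !(mulmx0, mul0mx).
rewrite -!scalemxAl mul_mu_T // -scalemxAl mul_munit // eqxx scalerA.
by rewrite -{2}(wt_cancel r) scalerA ebl (wt_block ebl); congr (_ *: _); ring.
Qed.

Definition mu_E := expA P s mu_a mu_b.

(* Kraus form: compressing by [F r first] replaces the trace on matrix
   units by a sum over the matrix units [delta_mx u v] of the ambient algebra. *)
Lemma psd_mu_E : (forall y : 'M[C]_N, B y -> tau y = \tr y) ->
  forall x : 'M[C]_N, B x -> psd x -> psd (mu_E x).
Proof.
move=> tauE x Bx [b ex].
pose f r := first (bl r).
pose G (l : 'I_N * 'I_N) : 'M[C]_N :=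
  \sum_r sqrtC ((wt r)^-1) *: (F r (f r) *m delta_mx l.1 l.2 *m F (f r) r).
have bf r : bl r = bl (f r) by rewrite bl_first.
suff -> : mu_E x = \sum_l adj (G l) *m x *m G l.
  apply: psd_sum => l; exists (b *m G l); rewrite adj_mul ex !mulmxA //.
have w0 r : 0 <= (wt r)^-1 by rewrite invr_ge0 wt_ge0.
have aG l : adj (G l) = \sum_r sqrtC ((wt r)^-1) *:
    (F r (f r) *m delta_mx l.2 l.1 *m F (f r) r).
  rewrite adj_sum; apply: eq_bigr => r _; rewrite adj_scale !adj_mul !adj_munit.
  by rewrite geC0_conj ?sqrtC_ge0 // /adj map_delta_mx trmx_delta !mulmxA.
transitivity (\sum_r \sum_c \sum_l (sqrtC ((wt r)^-1) * sqrtC ((wt c)^-1)) *: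
   (F r (f r) *m (delta_mx l.2 l.1 *m (F (f r) r *m x *m F c (f c)) *m delta_mx l.1 l.2)
     *m F (f c) c)); last first.
  rewrite exchange_big /= [RHS](eq_bigr (fun l => \sum_c \sum_r
    (sqrtC ((wt r)^-1) * sqrtC ((wt c)^-1)) *:
   (F r (f r) *m (delta_mx l.2 l.1 *m (F (f r) r *m x *m F c (f c)) *m delta_mx l.1 l.2)
     *m F (f c) c))) => [|l _].
    rewrite [RHS]exchange_big; apply: eq_bigr => c _ /=.
    by rewrite [RHS]exchange_big.
  rewrite aG mulmx_suml mulmx_sumr; apply: eq_bigr => c _.
  rewrite mulmx_suml; apply: eq_bigr => r _.
  by rewrite -!scalemxAl -scalemxAr scalerA !mulmxA.
rewrite /mu_E /expA -(pair_bigA _ (fun r c => tau (mu_b (r, c) *m x) *: mu_a (r, c))) /=.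
apply: eq_bigr => r _; apply: eq_bigr => c _; rewrite /mu_a /mu_b /=.
rewrite -scaler_sumr -mulmx_suml -mulmx_sumr.
have -> (z : 'M[C]_N) : \sum_(l : 'I_N * 'I_N)
    (delta_mx l.2 l.1 *m z *m delta_mx l.1 l.2 : 'M[C]_N) = (\tr z)%:M.
  rewrite -(pair_bigA _ (fun u v => delta_mx v u *m z *m delta_mx u v)) /=.
  transitivity (\sum_u \sum_v z u u *: (delta_mx v v : 'M[C]_N)).
    by apply: eq_bigr => u _; apply: eq_bigr => v _; apply: delta_sandwich.
  under eq_bigr do rewrite -scaler_sumr.
  rewrite -scaler_suml -scalemx1; congr (_ *: _).
  rewrite -diag_const_mx diag_mx_sum_delta; apply: eq_bigr => v _.
  by rewrite mxE scale1r.
rewrite mul_mx_scalar -[_ *m F (f c) c]scalemxAl mul_munit //.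
have [ebl|nb] := eqVneq (bl r) (bl c); last first.
  rewrite (munit0 nb) scaler0; case: eqP => [fe|_]; last by rewrite !scaler0.
  by move: nb; rewrite bf fe -bf eqxx.
rewrite /f ebl eqxx scalerA; congr (_ *: _).
have -> : \tr (F (first (bl c)) r *m x *m F c (first (bl c))) = \tr (F c r *m x).
  rewrite mxtrace_mulC mulmxA mul_munit ?bl_first // eqxx //.
rewrite -scalemxAl wtrZ tauE; last exact: (memBM P_mul B_def (munit_mem c r) Bx).
by rewrite (wt_block ebl) -expr2 sqrtCK.
Qed.

Theorem rep_index_bound E X : condexp B A E -> is_index B E X ->
  exists c : I -> C, [/\ X = \sum_i c i *: P i,
    tau (mu_R *m adj mu_R) <= \sum_i s i ^+ 2 * c i &
    (\sum_i s i ^+ 2 * c i = tau (mu_R *m adj mu_R) -> forall x : 'M[C]_N, B x -> E x = mu_E x)].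
Proof.
exact: (condexp_index_bound P_adj P_mul s_gt0 B_def A_subB A_mul_closed A_adj_closed
  A_wunit mu_a_mem mu_b_mem mu_dual_a mu_R_mem mu_aTb).
Qed.

Lemma rep_preserving_index E X : condexp B A E ->
  (forall x : 'M[C]_N, B x -> tau (E x) = tau x) -> is_index B E X ->
  X = \sum_i ((s i)^-1 * \tr (P i *m (mu_R *m adj mu_R))) *: P i.
Proof.
exact: (wtr_preserving_index P_adj P_mul s_gt0 B_def A_subB A_mul_closed A_adj_closed
  A_wunit mu_b_mem mu_dual_a mu_R_mem mu_aTb).
Qed.

Lemma rep_preserving_expA E : condexp B A E -> (forall x : 'M[C]_N, B x -> tau (E x) = tau x) ->
  forall x : 'M[C]_N, B x -> E x = mu_E x.
Proof.
exact: (wtr_preserving_expA P_adj P_mul s_gt0 B_def A_subB A_wunit mu_b_mem mu_dual_a).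
Qed.

Lemma rep_index_expA E : (forall x : 'M[C]_N, B x -> E x = mu_E x) ->
  is_index B E (\sum_i ((s i)^-1 * \tr (P i *m (mu_R *m adj mu_R))) *: P i).
Proof.
exact: (index_expA P_adj P_mul s_gt0 B_def A_subB A_mul_closed A_adj_closed
  mu_b_mem mu_R_mem mu_aTb mu_bTa).
Qed.

Lemma rep_condexp : (forall y : 'M[C]_N, B y -> tau y = \tr y) -> condexp B A mu_E.
Proof.
move=> tauE; apply: (condexp_expA P_mul B_def A_subB A_lin_closed A_mul_closed A_wunit
  mu_a_mem mu_b_mem mu_dual_a mu_dual_b).
exact: psd_mu_E.
Qed.

Lemma wtr_mu_E (x : 'M[C]_N) : B x -> tau (mu_E x) = tau x.
Proof.
move=> Bx; have Be := memB_wunit P_mul B_def.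
have := wtr_expA P_mul B_def A_subB mu_dual_b A_wunit Bx.
have EB : B (mu_E x) by apply: A_subB; apply: expA_mem; [exact: A_lin_closed | exact: A_wunit | exact: mu_a_mem].
by rewrite !(memB_mul1l P_mul B_def).
Qed.

Lemma tr_mu_T z : \tr (z *m (mu_R *m adj mu_R)) =
  \sum_r wt r / (k (bl r))%:R * \tr (z *m F r r).
Proof.
rewrite mu_T mulmx_sumr linear_sum /=; apply: eq_bigr => r _.
by rewrite -scalemxAr mxtraceZ.
Qed.

End Representation.
End Blocks.

(** * Central projections of a block-diagonal algebra *)

Section BlockUnits.
Variables (C : numClosedFieldType) (p : nat) (k : 'I_p -> nat).
Local Notation Nk := (\sum_j k j)%N.
Local Notation bl := (@tagnat.sig1 p k).
Local Notation u := (blockunit C k).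
Implicit Types (x y : 'M[C]_Nk) (r c : 'I_Nk).

Lemma mul_blockunit_l j x r c : (u j *m x) r c = if bl r == j then x r c else 0.
Proof.
rewrite blockunitE mxE (bigD1 r) //= [X in _ + X]big1 ?addr0 => [|i /negPf ne].
  by rewrite mxE eqxx /=; case: eqP; rewrite ?mul1r ?mul0r.
by rewrite mxE eq_sym ne mul0r.
Qed.

Lemma mul_blockunit_r j x r c : (x *m u j) r c = if bl c == j then x r c else 0.
Proof.
rewrite blockunitE mxE (bigD1 c) //= [X in _ + X]big1 ?addr0 => [|i /negPf ne].
  by rewrite mxE eqxx /=; case: eqP; rewrite ?mulr1 ?mulr0.
by rewrite mxE ne mulr0.
Qed.

Lemma blockunit_adj j : adj (u j) = u j.
Proof.
rewrite blockunitE; apply/matrixP => r c; rewrite !mxE eq_sym rmorph_nat.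
by case: eqVneq => // ->.
Qed.

Lemma blockunit_mul i j : u i *m u j = if i == j then u i else 0.
Proof.
apply/matrixP => r c; rewrite mul_blockunit_l !blockunitE mxE.
case: (eqVneq i j) => [<-|ne]; rewrite mxE; first by case: eqP; rewrite ?andbF.
by case: (bl r =P i) => // ->; rewrite (negPf ne) andbF.
Qed.

Lemma blockunit_sum : \sum_j u j = 1%:M.
Proof.
apply/matrixP => r c; rewrite summxE (bigD1 (bl r)) //= [X in _ + X]big1 ?addr0.
  by rewrite blockunitE !mxE eqxx andbT.
by move=> j /negPf ne; rewrite blockunitE mxE [bl r == j]eq_sym ne andbF.
Qed.

Lemma blockdiag_corners x : blockdiag k x <-> x = \sum_j u j *m x *m u j.
Proof.
have E : \sum_j u j *m x *m u j = \matrix_(r, c) (if bl r == bl c then x r c else 0).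
  apply/matrixP => r c; rewrite summxE mxE (bigD1 (bl r)) //= [X in _ + X]big1 ?addr0.
    by rewrite mul_blockunit_r mul_blockunit_l eqxx eq_sym.
  move=> j /negPf ne; rewrite mul_blockunit_r mul_blockunit_l [bl r == j]eq_sym ne.
  by case: eqP.
rewrite E; split=> [/blockdiagP bx|->].
  by apply/matrixP => r c; rewrite mxE; case: eqVneq => // /bx.
by apply/blockdiagP => r c /negPf ne; rewrite mxE ne.
Qed.

Lemma tr_blockunit_mul j x : \tr (u j *m x) = \tr (submxblock x j j).
Proof.
transitivity (\sum_i \sum_(a < k i) if i == j then x (tagnat.Rank i a) (tagnat.Rank i a) else 0).
  rewrite sig_big_dep /= (reindex _ tagnat.sig_bij_on).
  apply: eq_bigr => r _; rewrite mul_blockunit_l.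
  have -> : x r r = x (tagnat.Rank _ (tagnat.sig2 r)) (tagnat.Rank _ (tagnat.sig2 r)).
    by rewrite tagnat.sig2K.
  by [].
rewrite (bigD1 j) //= [X in _ + X]big1 ?addr0 => [|i /negPf ne]; last first.
  by rewrite ne big1.
by apply: eq_bigr => a _; rewrite eqxx mxE.
Qed.

Lemma tr_blockunit j : \tr (u j) = (k j)%:R.
Proof.
rewrite -[u j]mulmx1 tr_blockunit_mul; apply/eqP.
have -> : submxblock (1%:M : 'M[C]_Nk) j j = 1%:M; last by rewrite mxtrace1.
apply/matrixP => a b; rewrite !mxE -(val_eqE (tagnat.Rank j a)) /= tagnat.eq_Rank eqxx //.
Qed.

Lemma mul_blockunit_dlt j r c : u j *m dlt C r c = (bl r == j)%:R *: dlt C r c.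
Proof.
apply/matrixP => a b; rewrite mul_blockunit_l mxE.
rewrite /dlt; case: (bl r =P bl c) => _; rewrite !mxE ?mulr0 ?if_same //.
by case: (a =P r) => [->|_] /=; case: eqP; rewrite ?mul1r ?mul0r ?mulr0.
Qed.

End BlockUnits.

(** In a full-rank factorisation of an idempotent, cancelling the outer factors of [x *m x = x]
    leaves the identity of size the rank, and the trace is cyclic. *)
Lemma mxrank_idem (C : numClosedFieldType) N (x : 'M[C]_N) : x *m x = x -> (\rank x)%:R = \tr x.
Proof.
move=> xx; rewrite -{2}(mulmx_base x) mxtrace_mulC.
have -> : row_base x *m col_base x = 1%:M; last by rewrite mxtrace1.
apply: (row_free_inj (row_base_free x)); apply: (row_full_inj (col_base_full x)).
by rewrite mul1mx -(mulmxA (row_base x)) mulmx_base (mulmxA (col_base x)) mulmx_base.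
Qed.

(** * Bounds for operator norms *)

Section Opnorm.
Variable C : numClosedFieldType.

Lemma opnorm_le p q (x : 'M[C]_(p, q)) c : (0 < q)%N -> 0 <= c ->
  (forall v, vsq (x *m v) <= c ^+ 2 * vsq v) -> opnorm x <= c.
Proof.
move=> q0 c0 H; have [op0 _ /(_ q0) [v [v1 xv]] _] := opnorm_spec x.
by rewrite -ler_sqC // -xv (le_trans (H v)) // v1 mulr1.
Qed.

Lemma opnorm_ge p q (x : 'M[C]_(p, q)) c v : 0 <= c -> v != 0 ->
  vsq (x *m v) = c ^+ 2 * vsq v -> c <= opnorm x.
Proof.
move=> c0 v0 H; have [op0 /(_ v)] := opnorm_spec x; rewrite H ler_pM2r ?ler_sqC //.
rewrite lt_def vsq_ge0 andbT; apply: contraNneq v0 => /vsq_eq0 -> //.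
Qed.

(** The upper bound is positivity of the complementary projection; the lower one is attained at a
    nonzero column of [e], which [e] fixes. *)
Lemma opnorm_projection N (e : 'M[C]_N) c : adj e = e -> e *m e = e -> e != 0 ->
  0 <= c -> opnorm (c *: e) = c.
Proof.
move=> ae ee e0 c0; have N0 : (0 < N)%N.
  by case: N e ae ee e0 => // e _ _ /eqP[]; apply/matrixP => -[].
apply/le_anti/andP; split.
  apply: opnorm_le => // v; rewrite -scalemxAl vsqZ ger0_norm //.
  rewrite ler_wpM2l ?exprn_ge0 //; have := vsq_ge0 ((1%:M - e) *m v).
  have quad (f : 'M[C]_N) : adj f = f -> f *m f = f -> vsq (f *m v) = (ctr v *m f *m v) 0 0.
    move=> af ff; have cf : ctr f = f by [].
    by rewrite vsqE ctr_mul cf !mulmxA -(mulmxA _ f f) ff.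
  rewrite !quad //; last 2 first.
  - by rewrite adj_add adj_opp ae /adj map_mx1 trmx1.
  - by rewrite mulmxBr mulmx1 mulmxBl mul1mx ee subrr subr0.
  rewrite mulmxBr mulmx1 mulmxBl [X in 0 <= X]mxE [X in _ + X]mxE subr_ge0.
  by rewrite vsqE.
have [j ej] : exists j, col j e != 0.
  apply/existsP; apply: contraNT e0 => /existsPn H; apply/eqP/matrixP => a b.
  by have /eqP /matrixP /(_ a 0) := negPn (H b); rewrite !mxE.
apply: (opnorm_ge c0 ej); rewrite -scalemxAl vsqZ ger0_norm //.
by rewrite colE mulmxA ee.
Qed.

End Opnorm.

(** * Perron-Frobenius theory *)

Section PerronFrobenius.
Variables (C : numClosedFieldType) (m n : nat) (L : 'M[C]_(m, n)).
Hypothesis L_ge0 : forall i j, 0 <= L i j.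
Hypothesis L_row : forall i, exists j, L i j != 0.
Hypothesis L_col : forall j, exists i, L i j != 0.
(** Irreducibility as connectedness of the bipartite graph of [L]: a two-colouring that is constant
    along edges is constant. *)
Hypothesis L_irr : forall (S : pred 'I_m) (T : pred 'I_n),
  (forall i j, L i j != 0 -> S i = T j) -> forall i i', S i = S i'.

Lemma mul_row_gt0 (w : 'cV[C]_n) : (forall j, 0 < w j 0) -> forall i, 0 < (L *m w) i 0.
Proof.
move=> w0 i; have [j Lj] := L_row i; rewrite mxE (bigD1 j) //=.
apply: ltr_pwDl; first by rewrite mulr_gt0 // lt_def Lj L_ge0.
by apply: sumr_ge0 => j' _; rewrite mulr_ge0 ?(ltW (w0 _)).
Qed.

Lemma mul_col_gt0 (w : 'cV[C]_m) : (forall i, 0 < w i 0) -> forall j, 0 < (L^T *m w) j 0.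
Proof.
move=> w0 j; have [i Li] := L_col j; rewrite mxE (bigD1 i) //= mxE.
apply: ltr_pwDl; first by rewrite mulr_gt0 // lt_def Li L_ge0.
by apply: sumr_ge0 => i' _; rewrite mxE mulr_ge0 ?(ltW (w0 _)).
Qed.

(** By nonnegativity, the zero sets of [L *m y] and [y] form a colouring that is constant along the
    edges. It is thus constant, and [y] has a nonzero entry. *)
Lemma eigenvector_pos (y : 'cV[C]_n) c : (forall j, 0 <= y j 0) -> y != 0 ->
  L^T *m L *m y = c *: y -> forall j, 0 < y j 0.
Proof.
move=> y0 ynz ey; have Ly0 i : 0 <= (L *m y) i 0.
  by rewrite mxE; apply: sumr_ge0 => j _; rewrite mulr_ge0.
have irr := @L_irr (fun i => (L *m y) i 0 == 0) (fun j => y j 0 == 0).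
have {}irr i j : L i j != 0 -> ((L *m y) i 0 == 0) = (y j 0 == 0).
  move=> Lij; apply/eqP/eqP => [H|H].
    have /psumr_eq0P K : forall j, true -> 0 <= L i j * y j 0.
      by move=> j' _; rewrite mulr_ge0.
    move: H; rewrite mxE => /K /(_ j isT) /eqP.
    by rewrite mulf_eq0 (negPf Lij) => /eqP.
  have /psumr_eq0P K : forall i, true -> 0 <= L^T j i * (L *m y) i 0.
    by move=> i' _; rewrite mxE mulr_ge0.
  have : (L^T *m (L *m y)) j 0 = 0 by rewrite mulmxA ey mxE H mulr0.
  rewrite mxE => /K /(_ i isT) /eqP.
  by rewrite mulf_eq0 mxE (negPf Lij) => /eqP.
have all_eq := L_irr irr.
have [j1 nz1] : exists j, y j 0 != 0.
  apply/existsP; apply: contraNT ynz => /existsPn H; apply/eqP/matrixP => a b.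
  by rewrite ord1 mxE; apply/eqP/negPn/H.
move=> j; rewrite lt_def y0 andbT.
have [i Li] := L_col j; have [i1 Li1] := L_col j1.
by rewrite -(irr _ _ Li) (all_eq i i1) (irr _ _ Li1).
Qed.

(** Subtract from [y'] the largest multiple of [y] that keeps all entries nonnegative. The
    difference is an eigenvector with a zero entry, so it cannot be nonzero. *)
Lemma eigenvector_unique (y y' : 'cV[C]_n) c :
  (forall j, 0 < y j 0) -> (forall j, 0 < y' j 0) ->
  L^T *m L *m y = c *: y -> L^T *m L *m y' = c *: y' -> exists a, y' = a *: y.
Proof.
move=> y0 y'0 ey ey'.
have [n0|n0] := posnP n.
  by exists 0; apply/matrixP => j; have := ltn_ord j; rewrite {2}n0.
(* Negated ratios are maximised in order to find the smallest ratio. *)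
have [j0 H] : exists j, forall i, - (y' i 0 / y i 0) <= - (y' j 0 / y j 0).
  apply: exists_max => [|j]; first exact: Ordinal n0.
  by rewrite rpredN rpred_div // gtr0_real.
pose a := y' j0 0 / y j0 0; exists a.
apply/eqP; rewrite -subr_eq0; apply: contraT => nz.
have z0 j : 0 <= (y' - a *: y) j 0.
  by rewrite !mxE subr_ge0 -ler_pdivlMr //; have := H j; rewrite lerN2.
have := eigenvector_pos z0 nz (c := c).
rewrite mulmxBr -scalemxAr ey ey' scalerBr scalerA mulrC -scalerA => /(_ erefl j0).
by rewrite !mxE /a divfK ?subrr ?ltxx // gt_eqF.
Qed.

(** Replacing the entries of a norm-attaining vector by their absolute values does not decrease the
    norm of its image, so the new vector also attains the bound and is an eigenvector by the
    equality case. *)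
Lemma top_eigenvector : (0 < n)%N ->
  exists w : 'cV[C]_n, [/\ forall j, 0 < w j 0, \sum_j w j 0 ^+ 2 = 1 &
    L^T *m L *m w = opnorm L ^+ 2 *: w].
Proof.
move=> n0; have [op0 op_le /(_ n0) [v [v1 Lv]] op_eq] := opnorm_spec L.
have ctrL : ctr L = L^T.
  by apply/matrixP => i j; rewrite !mxE geC0_conj.
pose w : 'cV[C]_n := \col_j `|v j 0|.
have w1 : vsq w = 1.
  by rewrite -v1; apply: eq_bigr => j _; rewrite mxE normr_id.
have Lw : vsq (L *m w) = opnorm L ^+ 2 * vsq w.
  apply/le_anti; rewrite op_le w1 mulr1 -Lv; apply: ler_sum => i _.
  rewrite ler_pXn2r ?nnegrE ?normr_ge0 //.
  rewrite [X in _ <= X]ger0_norm ?mxE; last first.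
    by apply: sumr_ge0 => j _; rewrite mxE mulr_ge0.
  apply: le_trans (ler_norm_sum _ _ _) _; apply: ler_sum => j _.
  by rewrite mxE normrM ger0_norm.
have ew := op_eq w Lw; rewrite ctrL in ew.
have w_ge0 j : 0 <= w j 0 by rewrite mxE.
exists w; split=> //; first apply: eigenvector_pos ew => //.
  apply: contra_eq_neq w1 => ->; rewrite /vsq big1 ?(eq_sym 0) ?oner_eq0 // => j _.
  by rewrite mxE normr0 expr0n.
by rewrite -w1; apply: eq_bigr => j _; rewrite ger0_norm.
Qed.

End PerronFrobenius.

(** * The inclusion *)

Section MultimatrixInclusion.
Variables (C : numClosedFieldType) (m n : nat) (h : 'I_m -> nat) (k : 'I_n -> nat).
Variable phi : 'M[C]_(\sum_j k j) -> 'M[C]_(\sum_i h i).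
Hypothesis h_gt0 : forall i, (0 < h i)%N.
Hypothesis k_gt0 : forall j, (0 < k j)%N.
Hypothesis phi_incl : is_inclusion phi.
Local Notation Nk := (\sum_j k j)%N.
Local Notation Nh := (\sum_i h i)%N.
Local Notation bl := (@tagnat.sig1 n k).
Local Notation pM := (pM C h).
Local Notation qN := (qN phi).
Local Notation Lam := (bratteli phi).
Local Notation F := (munit phi).

Lemma phi_mem x : blockdiag k x -> Mset (phi x).
Proof. by case: phi_incl => -[H _ _ _ _] _; apply: H. Qed.
Lemma phi_lin (c : C) x y : blockdiag k x -> blockdiag k y ->
  phi (c *: x + y) = c *: phi x + phi y.
Proof. by case: phi_incl => -[_ H _ _ _] _; apply: H. Qed.
Lemma phi_mul x y : blockdiag k x -> blockdiag k y -> phi (x *m y) = phi x *m phi y.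
Proof. by case: phi_incl => -[_ _ H _ _] _; apply: H. Qed.
Lemma phi_adj x : blockdiag k x -> phi (adj x) = adj (phi x).
Proof. by case: phi_incl => -[_ _ _ H _] _; apply: H. Qed.
Lemma phi_unit : phi 1%:M = 1%:M.
Proof. by case: phi_incl => -[_ _ _ _ H] _. Qed.
Lemma phi_inj x y : blockdiag k x -> blockdiag k y -> phi x = phi y -> x = y.
Proof. by case: phi_incl => _; apply. Qed.

Lemma pM_adj i : adj (pM i) = pM i. Proof. exact: blockunit_adj. Qed.
Lemma pM_mul i i' : pM i *m pM i' = if i == i' then pM i else 0.
Proof. exact: blockunit_mul. Qed.
Lemma Mset_def (x : 'M[C]_Nh) : Mset x <-> x = \sum_i pM i *m x *m pM i.
Proof. exact: blockdiag_corners. Qed.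
Lemma wunit_pM : wunit pM = 1%:M. Proof. exact: blockunit_sum. Qed.
Lemma Nset_def (y : 'M[C]_Nh) : Nset phi y <-> exists x, blockdiag k x /\ y = phi x.
Proof. by []. Qed.
Lemma phi_wunit : phi 1%:M = wunit pM. Proof. by rewrite wunit_pM phi_unit. Qed.
Lemma pM_comm i x : Mset x -> pM i *m x = x *m pM i.
Proof. exact: (memB_comm pM_mul Mset_def). Qed.

Lemma phi0 : phi 0 = 0.
Proof. exact: (psi0 phi_lin). Qed.

Lemma qN_comm j x : blockdiag k x -> qN j *m phi x = phi x *m qN j.
Proof.
move=> bx; rewrite /Defs.qN -!phi_mul //; try exact: blockdiag_unit.
congr (phi _); exact: (memB_comm (@blockunit_mul C n k) (@blockdiag_corners C n k)).
Qed.

Lemma qN_mem j : Mset (qN j). Proof. exact/phi_mem/blockdiag_unit. Qed.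

Lemma qN_munit j r c : qN j *m F r c = (bl r == j)%:R *: F r c.
Proof.
rewrite /Defs.qN /munit -phi_mul; [|exact: blockdiag_unit|exact: blockdiag_dlt].
rewrite mul_blockunit_dlt -[_ *: _]addr0 phi_lin; [|exact: blockdiag_dlt|exact: blockdiag0].
by rewrite phi0 addr0.
Qed.

Let mulF := mul_munit phi_lin phi_mul.

Lemma munit_Mset r c : Mset (F r c). Proof. exact/phi_mem/blockdiag_dlt. Qed.

Lemma pM_idem_mul i x : Mset x -> x *m x = x -> pM i *m x *m (pM i *m x) = pM i *m x.
Proof.
move=> Mx xx; rewrite [pM i *m x *m _]mulmxA -(mulmxA (pM i)) -pM_comm // mulmxA.
by rewrite pM_mul eqxx -mulmxA xx.
Qed.

Lemma bratteliE i j : Lam i j = \tr (pM i *m F (first k_gt0 j) (first k_gt0 j)).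
Proof.
have bf : bl (first k_gt0 j) = bl (first k_gt0 j) by [].
rewrite mxE (minprojE C k_gt0) -(dltE C bf) mxrank_idem //.
by apply: pM_idem_mul; [exact: munit_Mset | rewrite mulF // eqxx].
Qed.

(** Diagonal matrix units of one block are equivalent through off-diagonal ones, and [pM i] is
    central in M. *)
Lemma tr_pM_munit i r : \tr (pM i *m F r r) = Lam i (bl r).
Proof.
rewrite bratteliE; set f := first k_gt0 (bl r).
have bf : bl r = bl f by rewrite bl_first.
have -> : F r r = F r f *m F f r by rewrite mulF // eqxx.
rewrite mulmxA mxtrace_mulC mulmxA -pM_comm; last exact: munit_Mset.
by rewrite -mulmxA mulF ?eqxx.
Qed.

Lemma tr_pM_qN i j : \tr (pM i *m qN j) = (k j)%:R * Lam i j.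
Proof.
have -> : pM i *m qN j = \sum_r (bl r == j)%:R *: (pM i *m F r r).
  rewrite -[qN j]mulmx1 -wunit_pM -(sum_munit phi_lin phi_wunit) !mulmx_sumr.
  by apply: eq_bigr => r _; rewrite qN_munit -scalemxAr.
rewrite linear_sum /=; under eq_bigr do rewrite mxtraceZ tr_pM_munit.
rewrite (sum_blocks k (fun j' => (j' == j)%:R * Lam i j' : C)) (bigD1 j) //=.
rewrite [X in _ + X]big1 ?addr0 => [|j' /negPf ->]; last by rewrite mul0r mul0rn.
by rewrite eqxx mul1r mulr_natl.
Qed.

Lemma qN_sum : \sum_j qN j = 1%:M.
Proof.
have [_ H] := psi_comb phi_lin (fun=> 1) (@blockdiag_unit C n k).
transitivity (\sum_j 1 *: qN j); first by apply: eq_bigr => j _; rewrite scale1r.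
rewrite -[LHS]H -phi_unit -(blockunit_sum C k); congr phi.
by apply: eq_bigr => j _; rewrite scale1r.
Qed.

(** Take traces in the decomposition of [pM i] as the sum of the [pM i *m qN j]. *)
Lemma bratteli_kvec : Lam *m kvec C k = hvec C h.
Proof.
apply/matrixP => i z; rewrite mxE [RHS]mxE -(tr_blockunit C h i) -/(pM i).
have -> : pM i = \sum_j pM i *m qN j.
  by rewrite -mulmx_sumr qN_sum mulmx1.
rewrite linear_sum /=; apply: eq_bigr => j _.
by rewrite tr_pM_qN [kvec _ _ _ _]mxE mulrC.
Qed.

Lemma bratteli_ge0 i j : 0 <= Lam i j. Proof. by rewrite mxE ler0n. Qed.

Lemma trstateE (s : 'cV[C]_m) x : trstate s x = wtr pM (fun i => s i 0) x.
Proof. by apply: eq_bigr => i _; rewrite tr_blockunit_mul. Qed.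

Lemma qN_adj j : adj (qN j) = qN j.
Proof. by rewrite /Defs.qN -phi_adj ?blockunit_adj //; apply: blockdiag_unit. Qed.

Lemma qN_idem j : qN j *m qN j = qN j.
Proof. by rewrite /Defs.qN -phi_mul ?blockunit_mul ?eqxx //; apply: blockdiag_unit. Qed.

(** * The factor inclusion cut out by [pM i *m qN j], and its minimal and Jones indices *)

Section Corner.
Variables (i : 'I_m) (j : 'I_n).
Local Notation e := (pM i *m qN j).

Lemma pq_comm : pM i *m qN j = qN j *m pM i. Proof. exact/pM_comm/qN_mem. Qed.

Lemma corner_idem : e *m e = e.
Proof. by apply: pM_idem_mul; [exact: qN_mem | exact: qN_idem]. Qed.

Lemma corner_adj : adj e = e.
Proof. by rewrite adj_mul pM_adj qN_adj pq_comm. Qed.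

Lemma corner_comm x : blockdiag k x -> e *m phi x = phi x *m e.
Proof.
move=> bx; rewrite -mulmxA qN_comm // !mulmxA pM_comm //; exact: phi_mem.
Qed.

Lemma bratteli_eq0 : Lam i j = 0 -> e = 0.
Proof.
move=> L0; apply: tr_mul_adj_eq0.
by rewrite corner_adj corner_idem tr_pM_qN L0 mulr0.
Qed.

Lemma corner_eq0 : e = 0 -> Lam i j = 0.
Proof.
move=> e0; have := tr_pM_qN i j; rewrite e0 mxtrace0 => /esym/eqP.
by rewrite mulf_eq0 pnatr_eq0 eqn0Ngt k_gt0 /= => /eqP.
Qed.

Definition cP (_ : 'I_1) : 'M[C]_Nh := e.
Definition cs (_ : 'I_1) : C := 1.
(** All summands of N except the j-th are sent to 0, so matrix units of weight 0 do occur here. *)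
Definition cpsi x : 'M[C]_Nh := e *m phi x.

Lemma cP_adj u : adj (cP u) = cP u. Proof. exact: corner_adj. Qed.
Lemma cP_mul u v : cP u *m cP v = if u == v then cP u else 0.
Proof. by rewrite !ord1 eqxx; exact: corner_idem. Qed.
Lemma cs_gt0 u : 0 < cs u. Proof. exact: ltr01. Qed.

Lemma redM_def (z : 'M[C]_Nh) : redM phi i j z <-> z = \sum_u cP u *m z *m cP u.
Proof.
rewrite big_ord1 /cP; split=> [[x [Mx ->]]|ez].
  have -> : qN j *m x *m pM i *m qN j = e *m x *m e.
    rewrite {1}pq_comm !mulmxA -(mulmxA _ (pM i) x) pM_comm // !mulmxA.
    by rewrite -(mulmxA _ (pM i) (pM i)) pM_mul eqxx.
  have -> : e *m (e *m x *m e) *m e = (e *m e) *m x *m (e *m e) by rewrite !mulmxA.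
  by rewrite corner_idem.
exists (pM i *m z *m pM i); split.
  by apply/Mset_def; have := memB_corner pM_mul Mset_def i z => /Mset_def.
by rewrite [LHS]ez {1}pq_comm !mulmxA -!(mulmxA _ (pM i) (pM i)) pM_mul eqxx.
Qed.

Lemma redN_def (z : 'M[C]_Nh) : redN phi i j z <-> exists x, blockdiag k x /\ z = cpsi x.
Proof.
split=> [[y [[x [bx ->]] ->]]|[x [bx ->]]].
  by exists x; rewrite /cpsi corner_comm // mulmxA.
by exists (phi x); split; [exists x | rewrite /cpsi corner_comm // mulmxA].
Qed.

Lemma cpsi_mem x : blockdiag k x -> redM phi i j (cpsi x).
Proof.
move=> bx; apply/redM_def; rewrite big_ord1 /cP /cpsi (mulmxA e e) corner_idem.
by rewrite -(mulmxA e (phi x)) -corner_comm // (mulmxA e e) corner_idem.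
Qed.

Lemma cpsi_lin (c : C) x y : blockdiag k x -> blockdiag k y ->
  cpsi (c *: x + y) = c *: cpsi x + cpsi y.
Proof. by move=> bx b_y; rewrite /cpsi phi_lin // mulmxDr -scalemxAr. Qed.

Lemma cpsi_mul x y : blockdiag k x -> blockdiag k y ->
  cpsi (x *m y) = cpsi x *m cpsi y.
Proof.
move=> bx b_y; rewrite /cpsi phi_mul // [RHS]mulmxA -(mulmxA e (phi x)) -corner_comm //.
by rewrite (mulmxA e e) corner_idem -(mulmxA e).
Qed.

Lemma cpsi_adj x : blockdiag k x -> cpsi (adj x) = adj (cpsi x).
Proof.
move=> bx; rewrite /cpsi adj_mul corner_adj -phi_adj // corner_comm //.
exact: blockdiag_adj.
Qed.

Lemma cpsi_unit : cpsi 1%:M = wunit cP.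
Proof. by rewrite /cpsi phi_unit mulmx1 /wunit big_ord1. Qed.

Lemma wtr_cP (y : 'M[C]_Nh) : redM phi i j y -> wtr cP cs y = \tr y.
Proof.
move=> By; have := memB_mul1l cP_mul redM_def By; rewrite /wunit big_ord1 => ey.
by rewrite /wtr big_ord1 mul1r ey.
Qed.

Lemma cpsi_munit r c : munit cpsi r c = (bl r == j)%:R *: (pM i *m F r c).
Proof. by rewrite /munit /cpsi -mulmxA qN_munit -scalemxAr. Qed.

Lemma wt_cpsi r : wt cP cs cpsi r = (bl r == j)%:R * Lam i j.
Proof.
rewrite /wt wtr_cP; last exact/cpsi_mem/blockdiag_dlt.
rewrite cpsi_munit mxtraceZ tr_pM_munit; case: eqP => [->|_] //; by rewrite !mul0r.
Qed.

Local Notation cT := (mu_R cP cs cpsi *m adj (mu_R cP cs cpsi)).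

(** The [k j] diagonal units of the block each contribute [Lam i j / k j] times the trace
    [Lam i j]. *)
Lemma wtr_cT : \tr (e *m cT) = Lam i j ^+ 2.
Proof.
rewrite (tr_mu_T cP_adj cP_mul cs_gt0 cpsi_lin cpsi_mul cpsi_adj).
pose f j' : C := (j' == j)%:R * (Lam i j ^+ 2 / (k j')%:R).
rewrite (eq_bigr (fun r => f (bl r))) => [|r _].
  rewrite sum_blocks (bigD1 j) //= [X in _ + X]big1 ?addr0 /f => [|j' /negPf ->].
    by rewrite eqxx mul1r -[LHS]mulr_natr divfK // pnatr_eq0 -lt0n.
  by rewrite mul0r mul0rn.
rewrite wt_cpsi; have -> : e *m munit cpsi r r = munit cpsi r r.
  by rewrite /munit /cpsi (mulmxA e e) corner_idem.
rewrite cpsi_munit mxtraceZ tr_pM_munit /f; case: eqP => [->|_]; last by rewrite !mul0r.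
by rewrite !mul1r expr2 mulrAC.
Qed.

Lemma corner_condexp : condexp (redM phi i j) (redN phi i j) (mu_E cP cs cpsi).
Proof.
apply: (rep_condexp k_gt0 cP_adj cP_mul cs_gt0 redM_def cpsi_mem cpsi_lin cpsi_mul
  cpsi_adj cpsi_unit redN_def); exact: wtr_cP.
Qed.

Lemma corner_index : is_index (redM phi i j) (mu_E cP cs cpsi) (Lam i j ^+ 2 *: e).
Proof.
have := rep_index_expA k_gt0 cP_adj cP_mul cs_gt0 redM_def cpsi_mem cpsi_lin cpsi_mul
  cpsi_adj cpsi_unit redN_def (fun x _ => erefl (mu_E cP cs cpsi x)).
by rewrite big_ord1 /cs invr1 mul1r wtr_cT.
Qed.

Lemma corner_index_ge E X : condexp (redM phi i j) (redN phi i j) E ->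
  is_index (redM phi i j) E X -> exists2 c, X = c *: e & Lam i j ^+ 2 <= c.
Proof.
move=> hE hX.
have [c [-> le_c _]] := rep_index_bound k_gt0 cP_adj cP_mul cs_gt0 redM_def cpsi_mem
  cpsi_lin cpsi_mul cpsi_adj cpsi_unit redN_def hE hX.
exists (c 0); first by rewrite big_ord1.
by move: le_c; rewrite /wtr !big_ord1 /cs expr1n !mul1r wtr_cT.
Qed.

(** With a single summand the weighted bound bounds the scalar index itself, and the
    trace-preserving expectation attains it. *)
Lemma minindex_corner : e != 0 -> minindex (redM phi i j) (redN phi i j) = Lam i j ^+ 2.
Proof.
move=> e0; have L2 : 0 <= Lam i j ^+ 2 by rewrite exprn_ge0 ?bratteli_ge0.
apply: infC_glb; split=> [x [E [X [hE [hX ->]]]]|u H].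
  have [c -> le_c] := corner_index_ge hE hX.
  by rewrite opnorm_projection ?corner_adj ?corner_idem // (le_trans L2).
apply: H; exists (mu_E cP cs cpsi), (Lam i j ^+ 2 *: e); split; first exact: corner_condexp.
by split; [exact: corner_index | rewrite opnorm_projection ?corner_adj ?corner_idem].
Qed.

(** Exhibiting the trace-preserving expectation activates the specification of [epsilon]; any
    expectation it picks has the same index, and [e != 0] lets the scalar be read off. *)
Lemma jones_corner : e != 0 -> jones (redM phi i j) (redN phi i j) e = Lam i j ^+ 2.
Proof.
move=> e0; rewrite /jones; set Q := (X in epsilon _ X).
have [E [X [hE [trE [hX eX]]]]] : Q (epsilon (inhabits 0) Q).
  apply: epsilon_spec; exists (Lam i j ^+ 2), (mu_E cP cs cpsi), (Lam i j ^+ 2 *: e).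
  split; [exact: corner_condexp | split; [|by split; [exact: corner_index|]]].
  move=> x Bx.
  have EB : redM phi i j (mu_E cP cs cpsi x).
    by case: corner_condexp => H _ _ _ _; have /redN_def[y [b_y ->]] := H x Bx; apply: cpsi_mem.
  by rewrite -!wtr_cP // (wtr_mu_E cP_adj cP_mul cs_gt0 redM_def cpsi_mem cpsi_lin cpsi_mul
    cpsi_adj cpsi_unit redN_def).
have := rep_preserving_index k_gt0 cP_adj cP_mul cs_gt0 redM_def cpsi_mem cpsi_lin
  cpsi_mul cpsi_adj cpsi_unit redN_def hE _ hX.
rewrite big_ord1 /cs invr1 mul1r wtr_cT eX => H.
have {}H : epsilon (inhabits 0) Q *: e = Lam i j ^+ 2 *: e.
  apply: H => x Bx; rewrite !wtr_cP ?trE //.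
  by case: hE => HE _ _ _ _; have /redN_def[y [b_y ->]] := HE x Bx; apply: cpsi_mem.
apply/eqP; rewrite -subr_eq0; move/eqP: H; rewrite -subr_eq0 -scalerBl.
by rewrite scaler_eq0 (negPf e0) orbF.
Qed.

End Corner.

Lemma matdim_bratteli : matdim phi = Lam.
Proof.
apply/matrixP => i j; rewrite mxE; case: ifPn => [e0|/negbNE/eqP e0].
  by rewrite minindex_corner // sqrCK ?bratteli_ge0.
by rewrite corner_eq0.
Qed.

Lemma jonesmat_bratteli : jonesmat phi = Lam.
Proof.
apply/matrixP => i j; rewrite mxE; case: ifPn => [e0|/negbNE/eqP e0].
  by rewrite jones_corner // sqrCK ?bratteli_ge0.
by rewrite corner_eq0.
Qed.

(** * The Markov trace and extremality *)

Section Markov.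
Variable s : 'cV[C]_m.
Hypothesis s_gt0 : forall i, 0 < s i 0.
Local Notation s' := (fun i => s i 0).
Local Notation T := (mu_R pM s' phi *m adj (mu_R pM s' phi)).

Lemma wt_phi r : wt pM s' phi r = (Lam^T *m s) (bl r) 0.
Proof.
rewrite /wt /wtr mxE; apply: eq_bigr => i _.
by rewrite tr_pM_munit [Lam^T _ _]mxE mulrC.
Qed.

(** The factor [k j] counting the diagonal units of a block cancels the denominator in [T]. For a
    Markov vector the value is [d ^+ 2 * s i 0], so the index is scalar. *)
Lemma tr_pM_T i : \tr (pM i *m T) = (Lam *m Lam^T *m s) i 0.
Proof.
rewrite (tr_mu_T pM_adj pM_mul s_gt0 phi_lin phi_mul phi_adj).
pose f j : C := (Lam^T *m s) j 0 / (k j)%:R * Lam i j.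
rewrite (eq_bigr (fun r => f (bl r))) => [|r _]; last by rewrite wt_phi tr_pM_munit.
rewrite sum_blocks -mulmxA mxE; apply: eq_bigr => j _.
by rewrite /f -[LHS]mulr_natr mulrAC divfK 1?mulrC // pnatr_eq0 -lt0n.
Qed.

(** Minimality bounds every entry of the index of [E0] by [d ^+ 2], hence their weighted sum by
    [tau T]. The general lower bound is the reverse inequality, and its equality case identifies
    [E0]. *)
Lemma markov_extremal E0 Et : is_minexp phi E0 -> markov_vec phi s ->
  preserves phi s Et -> forall x : 'M[C]_Nh, Mset x -> E0 x = Et x.
Proof.
move=> [hE0 [X0 [hX0 min0]]] [_ _ es] [hEt trEt] x Mx.
set d := opnorm Lam in es.
have d0 : 0 <= d by have [] := opnorm_spec Lam.
have trT i : \tr (pM i *m T) = d ^+ 2 * s i 0 by rewrite tr_pM_T es mxE.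
have wtrT : wtr pM s' T = \sum_i s i 0 ^+ 2 * d ^+ 2.
  by apply: eq_bigr => i _; rewrite trT expr2; ring.
have trEt' y : Mset y -> wtr pM s' (Et y) = wtr pM s' y.
  by move=> My; rewrite -!trstateE trEt.
have Et_mu (y : 'M[C]_Nh) : Mset y -> Et y = mu_E pM s' phi y.
  exact: (rep_preserving_expA pM_adj pM_mul s_gt0 Mset_def phi_mem phi_lin phi_mul
    phi_adj phi_wunit Nset_def hEt trEt').
have hXt : is_index (@Mset C m h) Et ((d ^+ 2)%:M).
  have := rep_index_expA k_gt0 pM_adj pM_mul s_gt0 Mset_def phi_mem phi_lin phi_mul
    phi_adj phi_wunit Nset_def Et_mu.
  congr is_index; rewrite -scalemx1 -wunit_pM scaler_sumr; apply: eq_bigr => i _.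
  by rewrite trT mulrCA mulVf ?mulr1 // gt_eqF.
have [N0|N0] := posnP Nh.
  by apply/matrixP => a; have := ltn_ord a; rewrite {2}N0.
(* [Et] has index [d ^+ 2] and competes in the minimisation defining [E0]. *)
have opX0 : opnorm X0 <= d ^+ 2.
  apply: le_trans (min0 _ _ hEt hXt) _; apply: opnorm_le; rewrite ?exprn_ge0 //.
  by move=> v; rewrite mul_scalar_mx vsqZ ger0_norm ?exprn_ge0.
have [c [eX0 le_c eq_c]] := rep_index_bound k_gt0 pM_adj pM_mul s_gt0 Mset_def phi_mem
  phi_lin phi_mul phi_adj phi_wunit Nset_def hE0 hX0.
rewrite Et_mu //; apply: eq_c => //; rewrite wtrT in le_c *.
have c_le i : `|c i| <= d ^+ 2.
  apply: le_trans opX0.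
  (* A basis vector in the i-th block is an eigenvector of [X0] with eigenvalue [c i]. *)
  pose v : 'cV[C]_Nh := delta_mx (first h_gt0 i) 0.
  apply: (@opnorm_ge _ _ _ _ _ v) => //.
    apply/eqP => /matrixP /(_ (first h_gt0 i) 0) /eqP.
    by rewrite !mxE !eqxx oner_eq0.
  have -> : X0 *m v = c i *: v; last by rewrite vsqZ.
  have pv i' : pM i' *m v = if i' == i then v else 0.
    rewrite /v -colE /Defs.pM blockunitE; apply/matrixP => a b; rewrite ord1 mxE mxE.
    case: (eqVneq i' i) => [->|ne]; rewrite mxE ?andbT.
      by case: eqP => // ->; rewrite bl_first eqxx.
    by case: eqP => // ->; rewrite bl_first eq_sym (negPf ne).
  transitivity (\sum_(i' | i' == i) c i' *: v); last by rewrite big_pred1_eq.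
  rewrite eX0 mulmx_suml [RHS]big_mkcond; apply: eq_bigr => i' _.
  by rewrite -scalemxAl pv; case: eqP; rewrite ?scaler0.
(* The [c i] are known only as complex numbers; their weighted sum is nonnegative because it
   dominates [tau T], so it may be estimated through absolute values. *)
have real_sum : \sum_i s i 0 ^+ 2 * c i = `|\sum_i s i 0 ^+ 2 * c i|.
  rewrite ger0_norm // (le_trans _ le_c) //; apply: sumr_ge0 => i _.
  by rewrite mulr_ge0 ?exprn_ge0 // ltW.
apply/le_anti; rewrite le_c andbT real_sum.
apply: le_trans (ler_norm_sum _ _ _) _; apply: ler_sum => i _.
by rewrite normrM ger0_norm ?ler_wpM2l ?exprn_ge0 // ltW.
Qed.

End Markov.

Lemma extremal_phi : extremal phi.
Proof.
move=> E0 s Et mE ms pE x Mx; have [s_gt0 _ _] := ms.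
exact: (markov_extremal s_gt0 mE ms pE Mx).
Qed.

(** * Irreducibility of the Bratteli matrix *)

Lemma bratteli_row i : exists j, Lam i j != 0.
Proof.
apply/existsP; apply: contraT => /existsPn H.
have /matrixP /(_ i 0) := bratteli_kvec.
rewrite mxE [RHS]mxE big1 => [/esym/eqP|j _].
  by rewrite pnatr_eq0 eqn0Ngt h_gt0.
by have /negPn/eqP -> := H j; rewrite mul0r.
Qed.

(** A zero column would give [qN j = 0], against injectivity of [phi]. *)
Lemma bratteli_col j : exists i, Lam i j != 0.
Proof.
apply/existsP; apply: contraT => /existsPn H.
have q0 : qN j = 0.
  rewrite -[qN j]mul1mx -wunit_pM /wunit mulmx_suml; apply: big1 => i _.
  by apply: bratteli_eq0; apply/eqP/negPn/H.
have := tr_blockunit C k j; rewrite (phi_inj (blockdiag_unit C k j) (blockdiag0 C k)).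
  by rewrite mxtrace0 => /esym/eqP; rewrite pnatr_eq0 eqn0Ngt k_gt0.
by rewrite phi0 -/(qN j).
Qed.

Hypothesis phi_conn : connected phi.

(** A colouring that is constant along edges makes the sum of the coloured [qN j] equal to the sum
    of the coloured [pM i]. This element is central in both algebras, hence scalar by
    connectedness. *)
Lemma bratteli_irr (S : pred 'I_m) (T : pred 'I_n) :
  (forall i j, Lam i j != 0 -> S i = T j) -> forall i i', S i = S i'.
Proof.
move=> ST.
pose z := \sum_j (T j)%:R *: qN j.
have [b_y ey] := psi_comb phi_lin (fun j => (T j)%:R) (@blockdiag_unit C n k).
have Nz : Nset phi z by exists (\sum_j (T j)%:R *: blockunit C k j); rewrite ey.
have pz i : pM i *m z = (S i)%:R *: pM i.
  rewrite -[pM i in RHS]mulmx1 -qN_sum !mulmx_sumr scaler_sumr.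
  apply: eq_bigr => j _; rewrite -scalemxAr.
  have [L0|L0] := eqVneq (Lam i j) 0; first by rewrite bratteli_eq0 // !scaler0.
  by rewrite (ST _ _ L0).
have Mz : Mset z by have [x [bx ->]] := Nz; apply: phi_mem.
have ez : z = \sum_i (S i)%:R *: pM i.
  rewrite -[LHS]mul1mx -wunit_pM /wunit mulmx_suml.
  by apply: eq_bigr => i _; rewrite pz.
have cz y : Mset y -> z *m y = y *m z.
  move=> My; rewrite ez mulmx_suml mulmx_sumr; apply: eq_bigr => i _.
  by rewrite -scalemxAl -scalemxAr pM_comm.
have [|//|c zc] := phi_conn (z := z).
- split=> // y [x [bx ->]]; apply: cz; exact: phi_mem.
have Sc i : (S i)%:R = c.
  have := pz i; rewrite zc mul_mx_scalar => /eqP.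
  rewrite -subr_eq0 -scalerBl scaler_eq0 subr_eq0 => /orP[/eqP //|/eqP p0].
  have := tr_blockunit C h i; rewrite -/(pM i) p0 mxtrace0 => /esym/eqP.
  by rewrite pnatr_eq0 eqn0Ngt h_gt0.
move=> i i'; have /eqP := etrans (Sc i) (esym (Sc i')).
by rewrite eqr_nat; case: (S i) (S i') => [] [].
Qed.

(** * Super-extremality and the eigenvector equation *)

Local Notation hv := (hvec C h).
Local Notation kv := (kvec C k).
Local Notation d := (opnorm Lam).

Lemma trstate_qN s j : trstate s (qN j) = (k j)%:R * (Lam^T *m s) j 0.
Proof.
rewrite trstateE /wtr mxE mulr_sumr; apply: eq_bigr => i _.
by rewrite tr_pM_qN [Lam^T _ _]mxE; ring.
Qed.

Lemma kvec_gt0 j : 0 < kv j 0. Proof. by rewrite mxE ltr0n. Qed.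

Lemma superextremal_of_eigen : Lam^T *m hv = d ^+ 2 *: kv -> superextremal phi.
Proof.
move=> eh; split; first exact: extremal_phi.
move=> s w [s0 s1 es] [w0 w1 ew] j; rewrite trstate_qN.
rewrite matdim_bratteli in ew.
have ek : Lam^T *m Lam *m kv = d ^+ 2 *: kv by rewrite -mulmxA bratteli_kvec.
have t0 := mul_col_gt0 bratteli_ge0 bratteli_col s0.
have et : Lam^T *m Lam *m (Lam^T *m s) = d ^+ 2 *: (Lam^T *m s).
  by rewrite -!mulmxA (mulmxA Lam) es -scalemxAr.
have uniq := eigenvector_unique bratteli_ge0 bratteli_col bratteli_irr kvec_gt0.
have [a ta] := uniq _ _ t0 ek et.
have [b wb] := uniq _ _ w0 ek ew.
have K0 : \sum_j kv j 0 ^+ 2 != 0.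
  rewrite gt_eqF // (bigD1 j) //= ltr_pwDl ?exprn_gt0 ?kvec_gt0 //.
  by apply: sumr_ge0 => i _; rewrite exprn_ge0 // ltW ?kvec_gt0.
(* Pairing [kv] with [Lam^T *m s] gives the pairing of [hv] with [s], which is 1 for a state. *)
have aK : a * \sum_j kv j 0 ^+ 2 = 1.
  rewrite -s1 mulr_sumr.
  transitivity ((kv^T *m (Lam^T *m s)) 0 0).
    rewrite ta mxE; apply: eq_bigr => j' _; rewrite [kv^T _ _]mxE [(a *: kv) _ _]mxE; ring.
  rewrite mulmxA -trmx_mul bratteli_kvec mxE; apply: eq_bigr => i _.
  by rewrite !mxE.
have bK : b ^+ 2 * \sum_j kv j 0 ^+ 2 = 1.
  rewrite -w1 wb mulr_sumr; apply: eq_bigr => j' _.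
  by rewrite [(b *: kv) _ _]mxE exprMn.
have ab : a = b ^+ 2 by apply: (mulIf K0); rewrite aK bK.
rewrite ta wb ab !mxE; ring.
Qed.

(** Super-extremality quantifies over Markov and Perron-Frobenius vectors, so a pair of them is
    constructed first; comparing the two states then makes [w] proportional to [kv]. *)
Lemma eigen_of_superextremal : superextremal phi -> Lam^T *m hv = d ^+ 2 *: kv.
Proof.
move=> [_ super].
have [n0|n0] := posnP n.
  by apply/matrixP => j; have := ltn_ord j; rewrite {2}n0.
have [w [w0 w1 ew]] := top_eigenvector bratteli_ge0 bratteli_col bratteli_irr n0.
have Lw0 := mul_row_gt0 bratteli_ge0 bratteli_row w0.
pose S := \sum_i (h i)%:R * (Lam *m w) i 0.
have [i0 _] := bratteli_col (Ordinal n0).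
have S0 : 0 < S.
  rewrite /S (bigD1 i0) //= ltr_pwDl ?mulr_gt0 ?ltr0n //.
  by apply: sumr_ge0 => i _; rewrite mulr_ge0 ?ler0n // ltW.
(* [Lam] carries an eigenvector of [Lam^T *m Lam] to one of [Lam *m Lam^T]; [S] normalises the trace
   of the unit to 1. *)
pose s := S^-1 *: (Lam *m w).
have ms : markov_vec phi s.
  split.
  - by move=> i; rewrite mxE mulr_gt0 ?invr_gt0.
  - rewrite (eq_bigr (fun i => S^-1 * ((h i)%:R * (Lam *m w) i 0))) => [|i _].
      by rewrite -mulr_sumr mulVf // gt_eqF.
    by rewrite [s _ _]mxE mulrCA.
  by rewrite -scalemxAr -!mulmxA (mulmxA Lam^T) ew -scalemxAr scalerA mulrC -scalerA.
have pw : pf_vec phi w by split=> //; rewrite matdim_bratteli.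
(* Here [tau (qN j)] equals both [(d ^+ 2 / S) * k j * w j 0] and [w j 0 ^+ 2]; one factor [w j 0]
   cancels. *)
have sw j : w j 0 = (d ^+ 2 / S) * kv j 0.
  have := super _ _ ms pw j; rewrite trstate_qN /s -scalemxAr mulmxA ew.
  rewrite !mxE => H.
  have w_nz : w j 0 != 0 by rewrite gt_eqF.
  by apply: (mulIf w_nz); rewrite -expr2 -H; ring.
have ewk : w = (d ^+ 2 / S) *: kv.
  by apply/matrixP => j z; rewrite ord1 sw [RHS]mxE.
have c0 : d ^+ 2 / S != 0.
  apply: contraTneq (w0 (Ordinal n0)) => c0.
  by rewrite ewk c0 scale0r mxE ltxx.
rewrite -bratteli_kvec mulmxA; apply: (scalerI c0).
rewrite scalemxAr; transitivity (d ^+ 2 *: w).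
  by rewrite -ew; congr (_ *m _); apply/esym/ewk.
transitivity (d ^+ 2 *: ((d ^+ 2 / S) *: kv)); first by congr (_ *: _); apply: ewk.
by rewrite scalerA [RHS]scalerA mulrC.
Qed.

End MultimatrixInclusion.

Theorem mainTheorem8 (C : numClosedFieldType) (m n : nat)
    (h : 'I_m -> nat) (k : 'I_n -> nat)
    (phi : 'M[C]_(\sum_j k j) -> 'M[C]_(\sum_i h i)) :
  (forall i, 0 < h i)%N -> (forall j, 0 < k j)%N ->
  is_inclusion phi -> connected phi ->
  [/\ matdim phi = bratteli phi,
      jonesmat phi = bratteli phi,
      extremal phi &
      (superextremal phi <->
         (bratteli phi)^T *m hvec C h = (opnorm (bratteli phi)) ^+ 2 *: kvec C k)].
Proof.
move=> h0 k0 incl conn; split.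
- exact: matdim_bratteli.
- exact: jonesmat_bratteli.
- exact: extremal_phi.
by split; [exact: eigen_of_superextremal | exact: superextremal_of_eigen].
Qed.
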